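(* For any sequence $\varrho=(r_n)_{n\in\mathbb{N}}$ in $[0,1)$ converging to $1$, there exists a function $f\in H(\mathbb{D})$ with the following two properties: (i) for no sequence $\varrho'$ in $[0,1)$ converging to $1$ is $f$ universal for $\mathcal{T}_{\varrho'}^{\{1\}}$; (ii) for every compact set $K\subset\mathbb{T}$ different from $\mathbb{T}$, the set $\{T_{\varrho,n}^K(f):n\in\mathbb{N}\}$ is somewhere dense in $\mathcal{C}(K)$ (i.e. its closure has non-empty interior).
   Context: $\mathbb{D}$ is the open unit disc of $\mathbb{C}$, $\mathbb{T}$ the unit circle, $H(\mathbb{D})$ the space of holomorphic functions on $\mathbb{D}$, and $\mathcal{C}(K)$ the space of continuous complex functions on a compact set $K$ with the uniform norm. For a sequence $\varrho=(r_n)_n$ in $[0,1)$ tending to $1$ and a compact $K\subset\mathbb{T}$, $T_{\varrho,n}^K:H(\mathbb{D})\to\mathcal{C}(K)$ is defined by $T_{\varrho,n}^K(f)(\zeta)=f(r_n\zeta)$, $\zeta\in K$, and $\mathcal{T}_\varrho^K=(T_{\varrho,n}^K)_{n\in\mathbb{N}}$. A function $f$ is universal for $\mathcal{T}_\varrho^K$ if $\{T_{\varrho,n}^K(f):n\in\mathbb{N}\}$ is dense in $\mathcal{C}(K)$. In particular, $f$ is universal for $\mathcal{T}_{\varrho'}^{\{1\}}$, $\varrho'=(r_n')_n$, if and only if $\{f(r_n'):n\in\mathbb{N}\}$ is dense in $\mathbb{C}$. *)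

(* Defs.v *)
From HB Require Import structures.
From mathcomp Require Import all_boot all_order all_algebra.
From mathcomp Require Import complex.
From mathcomp Require Import all_classical all_reals all_analysis.

Set Implicit Arguments.
Unset Strict Implicit.
Unset Printing Implicit Defensive.

Import Order.TTheory GRing.Theory Num.Theory.
Import numFieldNormedType.Exports.
(* From here on, function types and [continuousType X Y] carry the topology of
   uniform convergence. *)
Import ArrowAsUniformType.

Local Open Scope classical_set_scope.
Local Open Scope ring_scope.
Local Open Scope complex_scope.

Section radial_operators.
Variable R : realType.

(* [R[i]] itself has no topology in the library: its regular module
   [R[i]^o] is the complex normed line over [R[i]]. *)
Local Notation C := (R[i]^o).

Definition unit_disc : set C := [set z | `|z| < 1].

Definition unit_circle : set C := [set z | `|z| = 1].

(* The scalar field of [C] is [R[i]], so [derivable f z 1] is complex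
   differentiability at [z]. *)
Definition holomorphic_on (U : set C) (f : C -> C) :=
  forall z, U z -> derivable f z 1.

(* An element of H(D) is represented by a total function; its values outside
   of the disc are irrelevant. *)
Record holo_disc := HoloDisc {
  holo_fun :> C -> C;
  holo_funP : holomorphic_on unit_disc holo_fun }.

(* [set_type K] has the topology induced by [C]. *)
Definition contC (K : set C) : topologicalType := continuousType (set_type K) C.

Record radii := Radii {
  radius :> nat -> R;
  radius_itv : forall n, 0 <= radius n < 1;
  radius_cvg : radius @ \oo --> (1 : R) }.

Lemma radius_unit_disc (rho : radii) (n : nat) (z : C) :
  unit_circle z -> unit_disc ((rho n)%:C * z).
Proof.
rewrite /unit_circle /unit_disc /= => z1.
have /andP[r0 r1] := radius_itv rho n.
rewrite (_ : `|_| = `|(rho n)%:C| * `|z|); last exact: normrM.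
by rewrite z1 mulr1 ger0_norm ?(ler0c, ltcR) // -(ltcR (rho n) 1) in r1 *.
Qed.

Lemma holo_continuous (f : holo_disc) (z : C) :
  unit_disc z -> {for z, continuous f}.
Proof.
move=> /(@holo_funP f) /derivable1_diffP; exact: differentiable_continuous.
Qed.

Definition radial_fun (rho : radii) (K : set C) (n : nat) (f : holo_disc)
  (z : set_type K) : C := f ((rho n)%:C * \val z).

Lemma radial_fun_continuous (rho : radii) (K : set C) (KT : K `<=` unit_circle)
  (n : nat) (f : holo_disc) : continuous (@radial_fun rho K n f).
Proof.
move=> z; have Kz : unit_circle (\val z) by apply/KT/set_mem/(valP z).
have fc := @holo_continuous f _ (radius_unit_disc rho n Kz).
apply: (@continuous_comp _ _ _ (fun w : set_type K => (rho n)%:C * \val w : C) f);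
  last exact: fc.
apply: (@continuous_comp _ _ _ (fun w : set_type K => \val w : C)
  (fun w : C => (rho n)%:C * w : C)).
  exact: initial_continuous.
exact: (@scaler_continuous _ C (rho n)%:C).
Qed.

Definition radial_op (rho : radii) (K : set C) (KT : K `<=` unit_circle)
  (n : nat) (f : holo_disc) : contC K :=
  mkcts (@radial_fun_continuous rho K KT n f).

Definition radial_orbit (rho : radii) (K : set C) (KT : K `<=` unit_circle)
  (f : holo_disc) : set (contC K) :=
  range (fun n => radial_op rho KT n f).

Definition universal_for (rho : radii) (K : set C) (KT : K `<=` unit_circle)
  (f : holo_disc) : Prop := dense (radial_orbit rho KT f).

Lemma set1_unit_circle : [set (1 : C)] `<=` unit_circle.
Proof. by move=> _ ->; rewrite /unit_circle /=; exact: normr1. Qed.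

End radial_operators.

Arguments unit_disc R : clear implicits.
Arguments unit_circle R : clear implicits.
Arguments set1_unit_circle R : clear implicits.

Definition somewhere_dense (X : topologicalType) (A : set X) : Prop :=
  interior (closure A) !=set0.

(* Main.v *)
Require Import Defs.
From HB Require Import structures.
From mathcomp Require Import all_boot all_order all_algebra.
From mathcomp Require Import complex.
From mathcomp Require Import all_classical all_reals all_analysis.
From mathcomp Require Import cyclic separable cyclotomic.
From mathcomp Require Import ring lra zify.

Set Implicit Arguments.
Unset Strict Implicit.
Unset Printing Implicit Defensive.

Import Order.TTheory GRing.Theory Num.Theory.
Import numFieldNormedType.Exports.
Import ArrowAsUniformType.
Import Normc.

Local Open Scope classical_set_scope.
Local Open Scope ring_scope.
Local Open Scope complex_scope.

(** The function [f] is bounded on the radius from 0 to 1, which gives (i), and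
every continuous function on [K] with modulus less than 1 is in the closure of
its orbit, which gives (ii). It is the sum of a series of polynomials, small on
larger and larger discs, built step by step.

Suppose that the partial sum [S] is bounded by [B >= 1] on the radius and that,
outside of a gap around a point [z0 <> 1] of the circle, a polynomial [phi]
with [|phi 1| < 1] is to be approximated. The next partial sum is [S + H (phi -
S) = (1 - H) S + H phi], where the polynomial [H] is close to 0 on a disc of
radius [s < 1], close to 1 on the arc of radius [r > s] outside of the gap, and
close to values in [[0, 1]] on the radius ([cutoff_polynomial]). With [s] so
near to 1 that [|phi| <= 1] on [[s, 1]], the new sum is nearly a convex
combination of numbers bounded by [B] wherever [H] is not small, so the bound
on the radius survives up to an arbitrarily small error ([correction],
[partial_sums]).

The polynomial [H] approximates the rational function [q / (1 + q)], where [q z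
= (z / rho) ^ N] and [s < rho < r]. Its poles lie on the circle of radius
[rho], off the positive radius, and Runge's pole pushing moves them to infinity
through the gap ([polyapprox_pole_path], [polyapprox_pole_circle]).

The targets are enumerated: polynomials with coefficients in a countable dense
field, and gaps around a countable dense set of points. They suffice because
polynomials are uniformly dense in the continuous functions on a proper arc
([polyapprox_arc]): up to pole pushing once more, the arc is a real segment,
where Bernstein polynomials converge. A compact [K] that does not contain 1 is
enlarged by the point 1, where the target is given the value 0.

The limit is holomorphic by Cauchy's estimates, which for polynomials follow
from averaging over roots of unity ([cauchy_estimate], [limit_function]). *)

Local Notation Re := complex.Re.
Local Notation Im := complex.Im.

(** * The modulus as a real number *)

Section modulus.
Variable R : realType.
Local Notation C := R[i].
Implicit Types (x y z : C) (a b : R).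

(** The norm of [R[i]] takes its values in [R[i]]; [normc] is the same modulus,
   valued in [R]. *)
Lemma normrE z : `|z| = (normc z)%:C.
Proof. by case: z => a b; rewrite normc_def. Qed.

Lemma normcD x y : normc (x + y) <= normc x + normc y.
Proof. exact: le_normcD. Qed.

Lemma normc_opp x : normc (- x) = normc x.
Proof. exact: normcN. Qed.

Lemma normcB x y : normc (x - y) <= normc x + normc y.
Proof. by rewrite -(normc_opp y) normcD. Qed.

Lemma normc_distC x y : normc (x - y) = normc (y - x).
Proof. by rewrite -normc_opp opprB. Qed.

Lemma normc_dist x y z : normc (x - z) <= normc (x - y) + normc (y - z).
Proof. by rewrite -[x - z](subrKA y) normcD. Qed.

Lemma normc_ge0 z : 0 <= normc z.
Proof. by case: z => a b; rewrite /= sqrtr_ge0. Qed.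

Lemma normcX z n : normc (z ^+ n) = normc z ^+ n.
Proof.
elim: n => [|n IHn]; first by rewrite !expr0 -[RHS](@normc1 R).
by rewrite !exprS normcM IHn.
Qed.

Lemma normc_real a : normc a%:C = `|a|.
Proof. by rewrite /= expr0n addr0 sqrtr_sqr. Qed.

Lemma normc_nat n : normc (n%:R : C) = n%:R.
Proof. by rewrite -(rmorph_nat (real_complex R)) normc_real ger0_norm. Qed.

Lemma normc1C : normc (1 : C) = 1.
Proof. exact: normc1. Qed.

Lemma normc0C : normc (0 : C) = 0.
Proof. exact: normc0. Qed.

Lemma normc_i : normc ('i : C) = 1.
Proof. by rewrite /= expr0n expr1n add0r sqrtr1. Qed.

Lemma normc_eq0 z : (normc z == 0) = (z == 0).
Proof. by apply/eqP/eqP => [/eq0_normc //|->]; exact: normc0. Qed.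

Lemma normc_gt0 z : (0 < normc z) = (z != 0).
Proof. by rewrite lt_def normc_ge0 andbT normc_eq0. Qed.

Lemma sqr_normc_real z : normc z ^+ 2 = Re z ^+ 2 + Im z ^+ 2.
Proof. by case: z => a b; rewrite /= sqr_sqrtr // addr_ge0 // sqr_ge0. Qed.

Lemma Re_le_normc z : `|Re z| <= normc z.
Proof.
rewrite -(ler_pXn2r (n := 2)) ?nnegrE ?normc_ge0 //.
by rewrite sqr_normc_real real_normK ?num_real // lerDl sqr_ge0.
Qed.

Lemma Im_le_normc z : `|Im z| <= normc z.
Proof.
rewrite -(ler_pXn2r (n := 2)) ?nnegrE ?normc_ge0 //.
by rewrite sqr_normc_real real_normK ?num_real // lerDr sqr_ge0.
Qed.

Lemma normc_le_ReIm z : normc z <= `|Re z| + `|Im z|.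
Proof.
rewrite {1}[z]complexE (le_trans (normcD _ _)) // normcM normc_i mul1r.
by rewrite !normc_real.
Qed.

End modulus.

Lemma expr_small (R : realType) (q e : R) : 0 <= q < 1 -> 0 < e ->
  exists n, q ^+ n <= e.
Proof.
move=> /andP[q0 q1] e0; have /cvgrPdist_le/(_ e e0)[n _ /(_ n (leqnn n))] :
  GRing.exp q @ \oo --> (0 : R) by apply: cvg_expr; rewrite ger0_norm.
by rewrite sub0r normrN => h; exists n; rewrite (le_trans (ler_norm _)).
Qed.

(** * Uniform limits of polynomials and pole pushing *)

Section polynomial_approximation.
Variable R : realType.
Local Notation C := R[i].
Implicit Types (E : set C) (f g h : C -> C) (p q : {poly C}).

(** [f] is a uniform limit of polynomials on [E]. *)
Definition polyapprox E f := forall e : R, 0 < e ->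
  exists p : {poly C}, forall z, E z -> normc (p.[z] - f z) <= e.

Lemma polyapprox_ext E f g : (forall z, E z -> f z = g z) ->
  polyapprox E f -> polyapprox E g.
Proof.
by move=> fg Ef e /Ef[p pf]; exists p => z Ez; rewrite -fg //; exact: pf.
Qed.

Lemma polyapprox_poly E p : polyapprox E (horner p).
Proof. by move=> e e0; exists p => z _; rewrite subrr normc0 ltW. Qed.

Lemma polyapprox_cst E c : polyapprox E (cst c).
Proof.
by apply: polyapprox_ext (polyapprox_poly E c%:P) => z _; rewrite hornerC.
Qed.

Lemma polyapproxD E f g : polyapprox E f -> polyapprox E g ->
  polyapprox E (fun z => f z + g z).
Proof.
move=> Ef Eg e e0; have e2 : 0 < e / 2 by lra.
have [p pf] := Ef _ e2; have [q qg] := Eg _ e2.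
exists (p + q) => z Ez; rewrite hornerD.
rewrite (_ : _ - _ = (p.[z] - f z) + (q.[z] - g z)); last by ring.
have := normcD (p.[z] - f z) (q.[z] - g z); have := pf z Ez; have := qg z Ez.
lra.
Qed.

Lemma polyapprox_lim E f :
  (forall e : R, 0 < e -> exists2 g, polyapprox E g &
     forall z, E z -> normc (g z - f z) <= e) -> polyapprox E f.
Proof.
move=> Ef e e0; have e2 : 0 < e / 2 by lra.
have [g Eg gf] := Ef _ e2; have [p pg] := Eg _ e2.
exists p => z Ez; have := normc_dist p.[z] (g z) (f z).
have := pg z Ez; have := gf z Ez; lra.
Qed.

Lemma poly_bounded p : exists2 M : R, 0 < M &
  forall z, normc z <= 1 -> normc p.[z] <= M.
Proof.
elim/poly_ind: p => [|p c [M M0 pM]].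
  by exists 1 => // z _; rewrite horner0 normc0C.
exists (M + normc c) => [|z z1]; first by rewrite ltr_wpDr ?normc_ge0.
rewrite !hornerE (le_trans (normcD _ _)) // lerD2r normcM.
by rewrite (le_trans _ (pM z z1)) // ler_piMr ?normc_ge0.
Qed.

Section in_unit_disc.
Variable E : set C.
Hypothesis E1 : forall z, E z -> normc z <= 1.

Lemma polyapprox_bounded f : polyapprox E f ->
  exists2 M : R, 0 < M & forall z, E z -> normc (f z) <= M.
Proof.
move=> Ef; have [p pf] := Ef 1 ltr01; have [M M0 pM] := poly_bounded p.
exists (M + 1) => [|z Ez]; first by lra.
have := normc_dist (f z) p.[z] 0; have := pf z Ez; have := pM z (E1 Ez).
rewrite !subr0 (normc_distC (f z)); lra.
Qed.

Lemma polyapproxM f g : polyapprox E f -> polyapprox E g ->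
  polyapprox E (fun z => f z * g z).
Proof.
move=> Ef Eg e e0; have [M M0 fM] := polyapprox_bounded Ef.
have [|q qg] := Eg (e / 2 / M); first by rewrite !divr_gt0.
have [L L0 qL] := poly_bounded q.
have [|p pf] := Ef (e / 2 / L); first by rewrite !divr_gt0.
exists (p * q) => z Ez; rewrite hornerM.
rewrite (_ : _ - _ = (p.[z] - f z) * q.[z] + f z * (q.[z] - g z)); last by ring.
rewrite (le_trans (normcD _ _)) // !normcM (splitr e) lerD //.
  rewrite -[leRHS](divfK (lt0r_neq0 L0)).
  by rewrite ler_pM ?normc_ge0 ?pf ?qL ?E1.
rewrite -[leRHS](divfK (lt0r_neq0 M0)) mulrC.
by rewrite ler_pM ?normc_ge0 ?qg ?fM.
Qed.

Lemma polyapproxX f n : polyapprox E f -> polyapprox E (fun z => f z ^+ n).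
Proof.
move=> Ef; elim: n => [|n IHn].
  exact: polyapprox_ext (polyapprox_cst E 1).
apply: polyapprox_ext (polyapproxM Ef IHn) => z _; by rewrite exprS.
Qed.

(** The inverse is the sum of the geometric series of [h], uniformly on [E]. *)
Lemma polyapprox_inv1B h : polyapprox E h ->
  (forall z, E z -> normc (h z) <= 2^-1) ->
  polyapprox E (fun z => (1 - h z)^-1).
Proof.
move=> Eh h2; have nz z : E z -> 2^-1 <= normc (1 - h z).
  move=> Ez; have := normc_dist 1 (h z) 0; rewrite !subr0 normc1C.
  have := h2 z Ez; lra.
apply: polyapprox_lim => e e0.
have [||n ne] := @expr_small _ 2^-1 (e / 2); [lra|lra|].
exists (fun z => \sum_(k < n) h z ^+ k).
  elim: n {ne} => [|n IHn].
    by apply: polyapprox_ext (polyapprox_cst E 0) => z _; rewrite big_ord0.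
  apply: polyapprox_ext (polyapproxD IHn (polyapproxX n Eh)) => z _.
  by rewrite big_ord_recr.
move=> z Ez; have nz0 : 1 - h z != 0.
  by rewrite -normc_gt0; have := nz z Ez; lra.
have -> : \sum_(k < n) h z ^+ k - (1 - h z)^-1 = - (h z ^+ n / (1 - h z)).
  apply: (mulIf nz0); rewrite mulrBl mulNr divfK // mulVf //.
  by rewrite mulrC -(opprB (h z) 1) mulNr -subrX1; ring.
rewrite normc_opp normcM normcX normcV ler_pdivrMr ?normc_gt0 //.
have : normc (h z) ^+ n <= 2^-1 ^+ n.
  by rewrite lerXn2r ?nnegrE ?normc_ge0 ?h2 //; lra.
have := nz z Ez; nra.
Qed.

(** A pole may move by half of a lower bound [eta] for its distance to [E]: the
   Cauchy kernel of [w0] is a power series in that of [w1]. *)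
Lemma polyapprox_pole_near w0 w1 (eta : R) : 0 < eta ->
  (forall z, E z -> eta <= normc (z - w1)) -> normc (w0 - w1) <= eta / 2 ->
  polyapprox E (fun z => (z - w1)^-1) -> polyapprox E (fun z => (z - w0)^-1).
Proof.
move=> eta0 Ew1 w01 Ew.
have Eh := polyapproxM (polyapprox_cst E (w0 - w1)) Ew.
have nz z : E z -> z - w1 != 0 by move=> /Ew1 ?; rewrite -normc_gt0; lra.
have h2 z : E z -> normc ((w0 - w1) * (z - w1)^-1) <= 2^-1.
  move=> Ez; rewrite normcM normcV ler_pdivrMr ?normc_gt0 ?nz //.
  by have := Ew1 z Ez; lra.
apply: polyapprox_ext (polyapproxM Ew (polyapprox_inv1B Eh h2)) => z Ez /=.
rewrite -invfM mulrBr mulr1; congr (_^-1).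
rewrite mulrCA divff ?nz //; by ring.
Qed.

Lemma polyapprox_pole_far w : 2 <= normc w ->
  polyapprox E (fun z => (z - w)^-1).
Proof.
move=> w2; have w0 : w != 0 by rewrite -normc_gt0; lra.
have Eh : polyapprox E (fun z => w^-1 * z).
  apply: polyapprox_ext (polyapprox_poly E (w^-1 *: 'X)) => z _.
  by rewrite hornerZ hornerX.
have h2 z : E z -> normc (w^-1 * z) <= 2^-1.
  move=> Ez; rewrite normcM normcV ler_pdivrMl ?normc_gt0 //.
  by have := E1 Ez; lra.
apply: polyapprox_ext (polyapproxM (polyapprox_cst E (- w^-1))
  (polyapprox_inv1B Eh h2)) => z Ez /=.
have [e0|ne0] := eqVneq (z - w) 0.
  by exfalso; have := E1 Ez; move/eqP: e0; rewrite subr_eq0 => /eqP ->; lra.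
rewrite -invrN -invfM; congr (_^-1); field.
exact: w0.
Qed.

(** Runge's pole pushing along a Lipschitz path that stays away from [E]. *)
Lemma polyapprox_pole_path (gamma : R -> C) (a b L eta : R) :
  0 < eta -> 0 < L -> a <= b ->
  (forall t u, a <= t <= b -> a <= u <= b ->
     normc (gamma t - gamma u) <= L * `|t - u|) ->
  (forall t z, a <= t <= b -> E z -> eta <= normc (z - gamma t)) ->
  polyapprox E (fun z => (z - gamma a)^-1) ->
  polyapprox E (fun z => (z - gamma b)^-1).
Proof.
move=> eta0 L0 ab gL Eeta Ea.
(* so many steps that each of them moves the pole by at most [eta / 2] *)
pose n := (Num.truncn (2 * L * (b - a) / eta)).+1.
have n0 : (0 : R) < n%:R by rewrite ltr0n.
have nb : 2 * L * (b - a) <= eta * n%:R.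
  by rewrite -ler_pdivrMl // mulrC ltW // /n truncnS_gt // .
pose t (k : nat) := a + (b - a) * (k%:R / n%:R).
have tab k : (k <= n)%N -> a <= t k <= b.
  move=> kn; have : 0 <= k%:R / n%:R :> R by rewrite divr_ge0.
  have : k%:R / n%:R <= 1 :> R by rewrite ler_pdivrMr // mul1r ler_nat.
  by rewrite /t; nra.
suff Ek k : (k <= n)%N -> polyapprox E (fun z => (z - gamma (t k))^-1).
  by have := Ek n (leqnn n); rewrite /t divff ?lt0r_neq0 // mulr1 subrKC.
elim: k => [_|k IHk kn]; first by rewrite /t mul0r mulr0 addr0.
apply: (polyapprox_pole_near eta0 _ _ (IHk (ltnW kn))).
  by move=> z; apply: Eeta; exact/tab/ltnW.
apply: (le_trans (gL _ _ (tab _ kn) (tab _ (ltnW kn)))).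
have -> : t k.+1 - t k = (b - a) / n%:R.
  by rewrite /t -natr1; field; rewrite lt0r_neq0.
rewrite ger0_norm ?divr_ge0 ?subr_ge0 ?ler0n //.
by rewrite mulrA ler_pdivrMr //; lra.
Qed.

End in_unit_disc.
End polynomial_approximation.

(** * The unit circle *)

Section circle.
Variable R : realType.
Local Notation C := R[i].

(** Rational parametrisation of the unit circle without the point 1, by the
   real line. *)
Definition cayley (t : R) : C := (t%:C + 'i) / (t%:C - 'i).

Lemma normc_subi_ge1 (t : R) : 1 <= normc (t%:C - 'i).
Proof.
apply: le_trans (Im_le_normc _).
by rewrite /= sub0r normrN normr1.
Qed.

Lemma subi_neq0 (t : R) : t%:C - 'i != 0.
Proof. by rewrite -normc_gt0; have := normc_subi_ge1 t; lra. Qed.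

Lemma cayleyE t : cayley t = 1 + 2 * 'i / (t%:C - 'i).
Proof. by rewrite /cayley; field; exact: subi_neq0. Qed.

Lemma normc_cayley t : normc (cayley t) = 1.
Proof.
rewrite /cayley normcM normcV.
have -> : normc (t%:C + 'i) = normc (t%:C - 'i).
  by congr (Num.sqrt _); rewrite /=; ring.
by rewrite divff // normc_eq0 subi_neq0.
Qed.

Lemma cayley_onto (u : C) : normc u = 1 -> u <> 1 -> exists t, u = cayley t.
Proof.
case: u => a b u1 un1.
have ab : a ^+ 2 + b ^+ 2 = 1.
  by have := sqr_normc_real (a +i* b); rewrite u1 /= expr1n => ->.
have a1 : 1 - a != 0.
  rewrite subr_eq0; apply/negP => /eqP ea; apply: un1.
  move: ab; rewrite -ea expr1n => /eqP.
  by rewrite -subr_eq0 addrC addKr sqrf_eq0 => /eqP ->.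
exists (b / (1 - a)); apply: (mulIf (subi_neq0 (b / (1 - a)))).
rewrite /cayley divfK ?subi_neq0 //.
apply/eqP; rewrite eq_complex /=; apply/andP; split; apply/eqP.
  by field.
set t := b / (1 - a); have tE : t * (1 - a) = b by rewrite /t divfK.
apply: (mulIf a1).
have : b * (t * (1 - a)) = b ^+ 2 by rewrite tE.
move=> h; lra.
Qed.

Lemma cayley_lipschitz t u : normc (cayley t - cayley u) <= 2 * `|t - u|.
Proof.
have -> : cayley t - cayley u =
    2%:R * 'i * (u - t)%:C / ((t%:C - 'i) * (u%:C - 'i)).
  rewrite !cayleyE rmorphB; field; by rewrite !subi_neq0.
rewrite normcM normcV ler_pdivrMr; last first.
  by rewrite normc_gt0 mulf_neq0 ?subi_neq0.
rewrite !normcM normc_i mulr1 normc_real distrC.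
rewrite normc_nat.
have := normc_subi_ge1 t; have := normc_subi_ge1 u; have := normr_ge0 (t - u).
move=> h1 h2 h3; rewrite ler_peMr ?mulr_ge0 //.
by rewrite -[1]mulr1 ler_pM.
Qed.

Lemma cayley_dist1 t : 2 <= normc (1 - cayley t) * (`|t| + 1).
Proof.
have -> : 1 - cayley t = - (2%:R * 'i) / (t%:C - 'i).
  by rewrite cayleyE; ring.
rewrite normcM normc_opp normcM normc_i normcV mulr1 -mulrA.
rewrite normc_nat.
rewrite ler_peMr // mulrC ler_pdivlMr ?normc_gt0 ?subi_neq0 // mul1r.
by rewrite (le_trans (normcB _ _)) // normc_real normc_i.
Qed.

Lemma cayley_neq1 t : cayley t <> 1.
Proof.
move=> h; have := cayley_dist1 t; rewrite h subrr normc0C mul0r; lra.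
Qed.

(** Points of two rays issued from 0 are apart from each other, in proportion to
   the distance of one of them from 0. *)
Lemma ray_dist (u v : C) (x y : R) : normc u = 1 -> normc v = 1 ->
  0 <= x -> 0 <= y ->
  x * normc (v - u) <= 2 * normc (y%:C * v - x%:C * u).
Proof.
move=> u1 v1 x0 y0.
have hx : normc (x%:C * u) = x by rewrite normcM normc_real u1 mulr1 ger0_norm.
have hy : normc (y%:C * v) = y by rewrite normcM normc_real v1 mulr1 ger0_norm.
have h1 : `|x - y| <= normc (y%:C * v - x%:C * u).
  have := normc_dist (y%:C * v) (x%:C * u) 0.
  have := normc_dist (x%:C * u) (y%:C * v) 0.
  rewrite !subr0 hx hy (normc_distC (x%:C * u)) => *.
  by rewrite ler_norml; apply/andP; split; lra.
have -> : x * normc (v - u) =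
    normc ((x - y)%:C * v + (y%:C * v - x%:C * u)).
  rewrite -{1}[x]ger0_norm // -normc_real -normcM; congr normc.
  by rewrite rmorphB; ring.
apply: le_trans (normcD _ _) _; rewrite normcM normc_real v1 mulr1; lra.
Qed.

End circle.

(** * Poles on a circle crossing a keyhole *)

Section cutoff.
Variable R : realType.
Local Notation C := R[i].

(** A pole comes from infinity along the ray through [z0]. *)
Lemma polyapprox_pole_ray (E : set C) (z0 : C) (rho eta : R) :
  (forall z, E z -> normc z <= 1) -> normc z0 = 1 -> rho <= 2 -> 0 < eta ->
  (forall x z, rho <= x <= 2 -> E z -> eta <= normc (z - x%:C * z0)) ->
  polyapprox E (fun z => (z - rho%:C * z0)^-1).
Proof.
move=> E1 z01 rho2 eta0 Eeta.
pose gamma (x : R) := (2 - x)%:C * z0.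
have : polyapprox E (fun z => (z - gamma 0)^-1).
  apply: polyapprox_pole_far => //.
  by rewrite /gamma subr0 normcM z01 normc_real mulr1 ger0_norm.
rewrite -[rho](subKr 2) -/(gamma (2 - rho)).
apply: (@polyapprox_pole_path _ _ E1 gamma _ _ 1 eta) => //.
- by rewrite subr_ge0.
- move=> t u _ _; rewrite /gamma -mulrBl -rmorphB normcM normc_real z01 mulr1.
  by rewrite mul1r distrC (_ : _ - _ = t - u) //; ring.
- move=> t z /andP[t1 t2] Ez; apply: Eeta => //; apply/andP; split; lra.
Qed.

Variables (s r d : R) (z0 : C).

(** A closed disc of radius [s], a circle of radius [r] with a gap around [z0],
   and the radius from 0 to 1. *)
Definition keyhole : set C := [set z |
  [\/ normc z <= s,
      exists v, [/\ normc v = 1, d <= normc (v - z0) & z = r%:C * v] |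
      exists x : R, 0 <= x <= 1 /\ z = x%:C]].

Lemma keyhole_le1 z : 0 < s -> s < r -> r < 1 -> keyhole z -> normc z <= 1.
Proof.
move=> s0 sr r1.
case=> [zs|[v [v1 _ ->]]|[x [/andP[x0 x1] ->]]].
- lra.
- by rewrite normcM v1 mulr1 normc_real ger0_norm; lra.
- by rewrite normc_real ger0_norm.
Qed.

Lemma keyhole_dist_ray (rho x : R) z : 0 < s -> s < r -> 0 < d ->
  normc z0 = 1 -> s < rho -> rho <= x -> keyhole z ->
  Num.min (rho - s) (Num.min (rho * d / 2) (rho * normc (1 - z0) / 2))
    <= normc (z - x%:C * z0).
Proof.
move=> s0 sr d0 z01 srho rhox; have x0 : 0 <= x by lra.
case=> [zs|[v [v1 vd ->]]|[y [/andP[y0 y1] ->]]]; rewrite !ge_min.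
- apply/orP; left; have := normc_dist (x%:C * z0) z 0.
  rewrite !subr0 normcM z01 mulr1 normc_real ger0_norm // normc_distC; lra.
- have r0 : 0 <= r by lra.
  apply/orP; right; apply/orP; left.
  have := ray_dist z01 v1 x0 r0; nra.
- apply/orP; right; apply/orP; right.
  have := ray_dist z01 (normc1C R) x0 y0; rewrite mulr1.
  by have := normc_ge0 (1 - z0); nra.
Qed.

Lemma keyhole_dist_circle (rho : R) u z : 0 < s -> s < rho -> rho < r ->
  normc u = 1 -> keyhole z ->
  Num.min (rho - s) (Num.min (r - rho) (rho * normc (1 - u) / 2))
    <= normc (z - rho%:C * u).
Proof.
move=> s0 srho rhor u1; have rho0 : 0 <= rho by lra.
have nu : normc (rho%:C * u) = rho
  by rewrite normcM u1 mulr1 normc_real ger0_norm.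
case=> [zs|[v [v1 vd ->]]|[y [/andP[y0 y1] ->]]]; rewrite !ge_min.
- apply/orP; left; have := normc_dist (rho%:C * u) z 0.
  rewrite !subr0 nu normc_distC; lra.
- have r0 : 0 <= r by lra.
  apply/orP; right; apply/orP; left.
  have := normc_dist (r%:C * v) (rho%:C * u) 0.
  rewrite !subr0 nu normcM v1 mulr1 normc_real ger0_norm //; lra.
- apply/orP; right; apply/orP; right.
  have := ray_dist u1 (normc1C R) rho0 y0; rewrite mulr1; lra.
Qed.

(** A pole on a circle between the disc and the outer circle, off the radius,
   comes from infinity through the gap, then turns along its circle up to its
   place; the turn avoids the radius since it avoids the direction 1. *)
Lemma polyapprox_pole_circle (rho : R) u :
  0 < s -> s < rho -> rho < r -> r < 1 -> 0 < d -> normc z0 = 1 -> z0 <> 1 ->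
  normc u = 1 -> u <> 1 -> polyapprox keyhole (fun z => (z - rho%:C * u)^-1).
Proof.
move=> s0 srho rhor r1 d0 z01 z0n1 u1 un1.
have rho0 : 0 < rho by lra.
have sr : s < r by lra.
have E1 z : keyhole z -> normc z <= 1 by exact: keyhole_le1.
have dist1 (v : C) : v <> 1 -> 0 < normc (1 - v).
  by move=> /eqP vn1; rewrite normc_gt0 subr_eq0 eq_sym.
have start : polyapprox keyhole (fun z => (z - rho%:C * z0)^-1).
  apply: (polyapprox_pole_ray E1 z01); first by lra.
    shelve.
  move=> x z /andP[xrho _] Ez.
  exact: (keyhole_dist_ray s0 sr d0 z01 srho xrho Ez).
have [t0 z0E] := cayley_onto z01 z0n1; have [t1 uE] := cayley_onto u1 un1.
pose t x := t0 + x * (t1 - t0); pose gamma x := rho%:C * cayley (t x).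
pose T := `|t0| + `|t1| + 1.
have tT x : 0 <= x <= 1 -> `|t x| + 1 <= T.
  move=> /andP[x0 x1]; rewrite /T lerD2r.
  have -> : t x = (1 - x) * t0 + x * t1 by rewrite /t; ring.
  rewrite (le_trans (ler_normD _ _)) // !normrM.
  rewrite (ger0_norm x0) (@ger0_norm _ (1 - x)); last by lra.
  by have := normr_ge0 t0; have := normr_ge0 t1; nra.
have T0 : 0 < T by rewrite /T ltr_wpDl ?addr_ge0.
have -> : u = cayley (t 1) by rewrite /t mul1r subrKC.
move: start; rewrite z0E; have -> : t0 = t 0 by rewrite /t mul0r addr0.
rewrite -/(gamma 0) -/(gamma 1).
apply: (@polyapprox_pole_path _ _ E1 gamma _ _ (2 * rho * `|t1 - t0| + 1)
  (Num.min (rho - s) (Num.min (r - rho) (rho / T)))) => //.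
- by rewrite !lt_min !subr_gt0 srho rhor divr_gt0.
- by rewrite ltr_wpDl // !mulr_ge0 // ltW.
- move=> x y _ _; rewrite /gamma -mulrBr normcM normc_real (ger0_norm (ltW
  rho0)).
  have := cayley_lipschitz (t x) (t y).
  have -> : t x - t y = (x - y) * (t1 - t0) by rewrite /t; ring.
  rewrite normrM; have := normr_ge0 (x - y); have := normr_ge0 (t1 - t0).
  nra.
- move=> x z /tT xT Ez.
  apply: le_trans (keyhole_dist_circle s0 srho rhor (normc_cayley (t x)) Ez).
  rewrite !le_min !ge_min !lexx /= !orbT /= -mulrA ler_pM2l //.
  suff -> : T^-1 <= normc (1 - cayley (t x)) / 2 by rewrite !orbT.
  rewrite -[leLHS]mul1r ler_pdivrMr //.
  have := cayley_dist1 (t x); have := normc_ge0 (1 - cayley (t x)); nra.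
Unshelve.
rewrite !lt_min subr_gt0 srho !divr_gt0 ?mulr_gt0 //.
exact: dist1.
Qed.
End cutoff.

(** * The cutoff polynomial *)

Section cutoff_polynomial.
Variable R : realType.
Local Notation C := R[i].

Lemma polyapprox_inv_poly (E : set C) (p : {poly C}) :
  (forall z, E z -> normc z <= 1) ->
  (forall w, root p w -> polyapprox E (fun z => (z - w)^-1)) ->
  polyapprox E (fun z => p.[z]^-1).
Proof.
move=> E1; have [ws ->] := closed_field_poly_normal p.
have [->|lc0] := eqVneq (lead_coef p) 0.
  by move=> _; apply: polyapprox_ext (polyapprox_cst E 0^-1) => z _;
    rewrite scale0r horner0.
move=> Ews; have {Ews} Ews w : w \in ws -> polyapprox E (fun z => (z - w)^-1).
  by move=> wws; apply: Ews; rewrite rootZ // root_prod_XsubC.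
have : polyapprox E (fun z => (\prod_(w <- ws) ('X - w%:P)).[z]^-1).
  elim: ws Ews => [|w ws IHws] Ews.
    by apply: polyapprox_ext (polyapprox_cst E 1) => z _;
      rewrite big_nil hornerC invr1.
  have Ew := Ews w (mem_head _ _).
  have {}IHws : polyapprox E (fun z => (\prod_(w <- ws) ('X - w%:P)).[z]^-1).
    by apply: IHws => v vws; apply: Ews; rewrite in_cons vws orbT.
  apply: polyapprox_ext (polyapproxM E1 Ew IHws) => z _.
  by rewrite big_cons hornerM hornerXsubC invfM.
move=> /(polyapproxM E1 (polyapprox_cst E (lead_coef p)^-1)).
by apply: polyapprox_ext => z _; rewrite hornerZ invfM.
Qed.

(** With [q z = (z / rho) ^ N], [s < rho < r] and [N] large, the rational
   function [q / (1 + q)] is close to 0 on the disc, close to 1 on the outer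
   circle, and lies between 0 and 1 on the radius. Its poles have modulus [rho]
   and differ from [rho], because [1 + 1] is not 0, so it is a uniform limit of
   polynomials on the keyhole. *)
Lemma cutoff_polynomial (s r d : R) (z0 : C) (eta : R) :
  0 < s -> s < r -> r < 1 -> 0 < d -> normc z0 = 1 -> z0 <> 1 -> 0 < eta ->
  exists H : {poly C},
  [/\ forall z, normc z <= s -> normc H.[z] <= eta,
      forall v, normc v = 1 -> d <= normc (v - z0) ->
        normc (H.[r%:C * v] - 1) <= eta &
      forall x : R, 0 <= x <= 1 ->
        exists2 y : R, 0 <= y <= 1 & normc (H.[x%:C] - y%:C) <= eta].
Proof.
move=> s0 sr r1 d0 z01 z0n1 eta0.
have [rho srho rhor] : exists2 rho, s < rho & rho < r by exists ((s + r) / 2);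
  lra.
have rho0 : 0 < rho by lra.
have r0 : 0 < r by lra.
pose e := Num.min 2^-1 (eta / 4).
have e0 : 0 < e by rewrite lt_min; apply/andP; split; lra.
have e2 : e <= 2^-1 by rewrite ge_min lexx.
have e4 : e <= eta / 4 by rewrite ge_min lexx orbT.
have s1 : 0 <= s / rho by rewrite divr_ge0 ?ltW.
have r2 : 0 <= rho / r by rewrite divr_ge0 ?ltW.
have [|//|N Ne] := @expr_small _ (Num.max (s / rho) (rho / r)) e.
  by rewrite le_max s1 gt_max (ltr_pdivrMr _ _ rho0) (ltr_pdivrMr _ _ r0)
    !mul1r srho.
have sN : (s / rho) ^+ N <= e.
  by apply: le_trans Ne; rewrite lerXn2r ?nnegrE ?le_max ?lexx ?s1.
have rN : (rho / r) ^+ N <= e.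
  by apply: le_trans Ne; rewrite lerXn2r ?nnegrE ?le_max ?lexx ?s1 ?r2 ?orbT.
have rhoC0 : rho%:C != 0 :> C
  by rewrite -normc_gt0 normc_real normr_gt0 lt0r_neq0.
pose q (z : C) := (z / rho%:C) ^+ N.
have nq z : normc (q z) = (normc z / rho) ^+ N.
  by rewrite /q normcX normcM normcV normc_real (ger0_norm (ltW rho0)).
pose p : {poly C} := 1 + (rho%:C^-1 ^+ N) *: 'X^N.
have pE z : p.[z] = 1 + q z.
  by rewrite /p /q !hornerE exprMn mulrC.
have E1 z : keyhole s r d z0 z -> normc z <= 1 by exact: keyhole_le1.
have Ep : polyapprox (keyhole s r d z0) (fun z => p.[z]^-1).
  apply: (polyapprox_inv_poly E1) => w; rewrite rootE pE => /eqP qw.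
  pose u := w / rho%:C; have -> : w = rho%:C * u by rewrite mulrC divfK.
  have uN : u ^+ N = -1 by apply/eqP; rewrite -addr_eq0 addrC -/(q w) qw.
  have n11 : (1 : C) <> -1.
    by move=> /eqP; rewrite -addr_eq0 -[1 + 1]/(2%:R) pnatr_eq0.
  (* [N = 0] would give [1 = -1] *)
  have N0 : (0 < N)%N by case: (N) uN => [|//]; rewrite expr0.
  apply: (polyapprox_pole_circle s0 srho rhor r1 d0 z01 z0n1).
    apply/eqP; rewrite -(pexpr_eq1 N0) ?normc_ge0 // -normcX uN.
    by rewrite normc_opp normc1C.
  by move=> u1; move: uN; rewrite u1 expr1n.
have eta2 : 0 < eta / 2 by lra.
have [g gG] := Ep _ eta2.
have nq1 z : 1 - normc (q z) <= normc (1 + q z).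
  have := normc_dist 1 (- q z) 0; rewrite !subr0 opprK normc1C normc_opp; lra.
have nq2 z : normc (q z) - 1 <= normc (1 + q z).
  have := normc_dist (q z) (-1) 0; rewrite !subr0 opprK normc_opp normc1C.
  by rewrite (addrC (q z)); lra.
exists (1 - g); split.
- move=> z zs; rewrite !hornerE.
  have qe : normc (q z) <= e.
    rewrite nq; apply: le_trans sN; rewrite lerXn2r ?nnegrE //.
    - by rewrite divr_ge0 ?normc_ge0 ?ltW.
    - by rewrite ler_pM2r ?invr_gt0.
  have q1 : 2^-1 <= normc (1 + q z) by have := nq1 z; lra.
  have nz : 1 + q z != 0 by rewrite -normc_gt0; lra.
  have Ez : keyhole s r d z0 z by apply: Or31.
  have := gG z Ez; rewrite pE normc_distC => gz.
  have -> : 1 - g.[z] = q z / (1 + q z) + ((1 + q z)^-1 - g.[z]).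
    by field.
  rewrite (le_trans (normcD _ _)) // (splitr eta) lerD // normcM normcV.
  rewrite ler_pdivrMr ?normc_gt0 //; nra.
- move=> v v1 vd; rewrite !hornerE.
  have Ez : keyhole s r d z0 (r%:C * v) by apply: Or32; exists v.
  move: Ez; set z := r%:C * v => Ez; have := gG z Ez; rewrite pE.
  have qe : 1 <= e * normc (q z).
    have -> : normc (q z) = (r / rho) ^+ N.
      by rewrite nq normcM v1 mulr1 normc_real (ger0_norm (ltW r0)).
    have -> : (1 : R) = (rho / r) ^+ N * (r / rho) ^+ N.
      by rewrite -exprMn -[rho / r]invf_div mulVf ?expr1n // mulf_neq0
        ?invr_neq0 ?lt0r_neq0.
    by apply: ler_wpM2r => //; apply: exprn_ge0; rewrite divr_ge0 // ltW.
  have q1 : 1 <= 2 * e * normc (1 + q z).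
    by have := nq2 z; have := normc_ge0 (q z); nra.
  have nz : 1 + q z != 0.
    rewrite -normc_gt0 lt_def normc_ge0 andbT; apply/eqP => h.
    move: q1; rewrite h mulr0; lra.
  move=> gz; have := normc_dist g.[z] (1 + q z)^-1 0; rewrite !subr0.
  have : normc (1 + q z)^-1 <= eta / 2.
    by rewrite normcV -[leLHS]mul1r ler_pdivrMr ?normc_gt0 //; nra.
  have -> : 1 - g.[z] - 1 = - g.[z] by ring.
  by rewrite normc_opp; lra.
- move=> x x01; have /andP[x0 x1] := x01; rewrite !hornerE.
  have Ez : keyhole s r d z0 x%:C by apply: Or33; exists x.
  pose t := (x / rho) ^+ N; have t0 : 0 <= t.
    by apply: exprn_ge0; rewrite divr_ge0 // ltW.
  have qt : q x%:C = t%:C by rewrite /q /t rmorphXn rmorphM fmorphV.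
  exists (1 - (1 + t)^-1).
    have : 0 <= (1 + t)^-1 by rewrite invr_ge0; lra.
    have : (1 + t)^-1 <= 1 by rewrite invf_le1; lra.
    by move=> *; apply/andP; split; lra.
  have := gG _ Ez; rewrite pE qt.
  have -> : 1 - g.[x%:C] - (1 - (1 + t)^-1)%:C = - (g.[x%:C] - (1 + t%:C)^-1).
    by rewrite rmorphB fmorphV rmorphD rmorph1; ring.
  rewrite normc_opp; lra.
Qed.
End cutoff_polynomial.

(** * Density of polynomials on proper arcs *)

Section density.
Variable R : realType.
Local Notation C := R[i].

(** [bernstein t n g] is the mean of [g] under the binomial law with
   parameters [n] and [t], i.e., the Bernstein polynomial of the samples [g]. *)
Fixpoint bernstein (t : C) (n : nat) (g : nat -> C) : C :=
  if n is m.+1 then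
    (1 - t) * bernstein t m g + t * bernstein t m (fun k => g k.+1)
  else g 0%N.

(** The quadratic term is the second moment of the binomial law about [- e]. *)
Lemma bernstein_dist (t a b e : R) (c : C) n (g : nat -> C) : 0 <= t <= 1 ->
  (forall k, normc (g k - c) <= a + b * (k%:R + e) ^+ 2) ->
  normc (bernstein t%:C n g - c)
    <= a + b * (n%:R * (t * (1 - t)) + (n%:R * t + e) ^+ 2).
Proof.
move=> /andP[t0 t1]; elim: n e g => [|n IHn] e g gc.
  by rewrite /= !mul0r !add0r; have := gc 0%N; rewrite add0r.
have h1 := IHn e g gc.
have h2 : normc (bernstein t%:C n (fun k => g k.+1) - c) <=
    a + b * (n%:R * (t * (1 - t)) + (n%:R * t + (e + 1)) ^+ 2).
  apply: IHn => k; have := gc k.+1; rewrite -natr1.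
  by rewrite (_ : k%:R + 1 + e = k%:R + (e + 1)) //; ring.
have -> : bernstein t%:C n.+1 g - c = (1 - t)%:C * (bernstein t%:C n g - c)
   + t%:C * (bernstein t%:C n (fun k => g k.+1) - c).
  by rewrite /= rmorphB rmorph1; ring.
apply: le_trans (normcD _ _) _; rewrite !normcM !normc_real.
rewrite (ger0_norm t0) ger0_norm; last by lra.
have t1' : 0 <= 1 - t by lra.
have h1' := ler_wpM2l t1' h1.
have h2' := ler_wpM2l t0 h2.
apply: le_trans (lerD h1' h2') _; rewrite le_eqVlt; apply/orP; left.
by apply/eqP; rewrite -natr1; ring.
Qed.

Lemma polyapprox_bernstein (E : set C) (t : C -> C) n (g : nat -> C) :
  (forall z, E z -> normc z <= 1) -> polyapprox E t ->
  polyapprox E (fun z => bernstein (t z) n g).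
Proof.
move=> E1 Et; have Et' : polyapprox E (fun z => 1 - t z).
  apply: polyapprox_ext (polyapproxD (polyapprox_cst E 1)
    (polyapproxM E1 (polyapprox_cst E (-1)) Et)) => z _.
  by rewrite /= mulN1r.
elim: n g => [|n IHn] g; first exact: polyapprox_cst.
exact: polyapproxD (polyapproxM E1 Et' (IHn _)) (polyapproxM E1 Et (IHn _)).
Qed.

(** Uniform continuity on [K] of a function defined everywhere. *)
Definition unif_cont_on (K : set C) (psi : C -> C) := forall e : R, 0 < e ->
  exists2 delta : R, 0 < delta & forall x y, K x -> K y ->
    normc (x - y) <= delta -> normc (psi x - psi y) <= e.

(** The inverse of [cayley], rotated so that the missing point is [z0], is a
   real-valued function on [K] and a uniform limit of polynomials there;
   Bernstein polynomials in this coordinate converge to [psi]. *)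
Lemma polyapprox_arc (K : set C) (z0 : C) (d M : R) (psi : C -> C) :
  normc z0 = 1 -> 0 < d ->
  (forall v, K v -> normc v = 1 /\ d <= normc (v - z0)) ->
  (forall v, K v -> normc (psi v) <= M) -> unif_cont_on K psi ->
  polyapprox K psi.
Proof.
move=> z01 d0 Karc KM Kuc.
have K1 z : K z -> normc z <= 1 by move=> /Karc[->].
have z00 : z0 != 0 by rewrite -normc_gt0 z01.
have Kz0 : polyapprox K (fun z => (z - z0)^-1).
  have -> : z0 = 1%:C * z0 by rewrite mul1r.
  apply: (@polyapprox_pole_ray _ _ _ _ (d / 2) K1 z01).
  - by lra.
  - by lra.
  - move=> x z /andP[x1 x2] /Karc[v1 vd]; have x0 : 0 <= x by lra.
    have := ray_dist z01 v1 x0 ler01; rewrite mul1r; nra.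
(* [S z] is the real [s] such that [z = z0 * cayley s] *)
pose S z := - 'i * (- (2%:R * z0) * (z - z0)^-1 - 1).
have KS : polyapprox K S.
  apply: polyapprox_ext (polyapproxM K1 (polyapprox_cst K (- 'i))
    (polyapproxD (polyapproxM K1 (polyapprox_cst K (- (2%:R * z0))) Kz0)
    (polyapprox_cst K (-1)))) => z _ //.
pose A := 2 / d + 1; have A0 : 0 < A.
  by have : 0 < 2 / d by [rewrite divr_gt0]; rewrite /A; lra.
pose sg z := Re (S z).
have SP z : K z -> [/\ S z = (sg z)%:C, z = z0 * cayley (sg z) & `|sg z| <= A].
  move=> Kz; have [v1 vd] := Karc z Kz.
  have zz0 : z - z0 != 0 by rewrite -normc_gt0; lra.
  have [||s us] := @cayley_onto _ (z / z0).
  - by rewrite normcM normcV v1 z01 divr1.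
  - move=> h; move/eqP: zz0; apply.
    by rewrite -[z](divfK z00) h mul1r subrr.
  have zE : z = z0 * cayley s by rewrite -us mulrC divfK.
  have SzE : S z = s%:C.
    have ii : 'i * 'i = -1 :> C by rewrite -expr2 sqr_i.
    rewrite /S; have -> : z - z0 = z0 * (2%:R * 'i) / (s%:C - 'i).
      by rewrite zE cayleyE; ring.
    have i0 : ('i : C) != 0 by rewrite -normc_gt0 normc_i.
    have -> : (z0 * (2%:R * 'i) / (s%:C - 'i))^-1
      = - 'i * (s%:C - 'i) / (2%:R * z0).
      apply: (mulrI (x := z0 * (2%:R * 'i) / (s%:C - 'i))).
        by rewrite unitfE !mulf_neq0 ?invr_neq0 ?subi_neq0 ?pnatr_eq0.
      rewrite divff ?mulf_neq0 ?invr_neq0 ?subi_neq0 ?pnatr_eq0 //.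
      transitivity (- ('i * 'i) : C); first by rewrite ii opprK.
      by field; rewrite z00 subi_neq0.
    transitivity (- ('i * 'i) * s%:C + 'i * ('i * 'i) + 'i : C).
      by field.
    by rewrite ii opprK; ring.
  have sE : sg z = s by rewrite /sg SzE.
  rewrite sE; split => //; rewrite -normc_real -SzE /S.
  rewrite normcM normc_opp normc_i mul1r.
  apply: le_trans (normcB _ _) _; rewrite normc1C /A lerD2r.
  rewrite normcM normc_opp normcM z01 mulr1 normc_nat normcV.
  by rewrite ler_pM2l // lef_pV2 // posrE normc_gt0.
pose t z := (sg z / A + 1) / 2.
have t01 z : K z -> 0 <= t z <= 1.
  move=> /SP[_ _]; rewrite ler_norml => /andP[h1 h2].
  have : -1 <= sg z / A by rewrite ler_pdivlMr // mulN1r.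
  have : sg z / A <= 1 by rewrite ler_pdivrMr // mul1r.
  by rewrite /t => *; apply/andP; split; lra.
have tdist x y : K x -> K y -> normc (x - y) <= 4 * A * `|t x - t y|.
  move=> Kx Ky; have [_ xE _] := SP x Kx; have [_ yE _] := SP y Ky.
  rewrite {1}xE {1}yE -mulrBr normcM z01 mul1r.
  apply: le_trans (cayley_lipschitz _ _) _.
  have -> : sg x - sg y = 2 * A * (t x - t y).
    by rewrite /t; field; rewrite lt0r_neq0.
  by rewrite normrM ger0_norm ?mulr_ge0 ?(ltW A0) //; lra.
have Kt : polyapprox K (fun z => (t z)%:C).
  apply: polyapprox_ext (polyapproxM K1 (polyapproxD (polyapproxM K1 KS
    (polyapprox_cst K (A^-1)%:C)) (polyapprox_cst K 1))
    (polyapprox_cst K (2^-1)%:C)) => z Kz /=.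
  have [-> _ _] := SP z Kz.
  by rewrite /t !rmorphM rmorphD rmorphM rmorph1.
apply: polyapprox_lim => e e0.
have e2 : 0 < e / 2 by lra.
have [delta delta0 Kd] := Kuc _ e2.
pose eta := delta / (4 * A).
have eta0 : 0 < eta by rewrite divr_gt0 // mulr_gt0.
have etaE : 4 * A * eta = delta.
  by rewrite /eta mulrC divfK // lt0r_neq0 // mulr_gt0.
pose B := 8 * `|M| / eta ^+ 2.
have B0 : 0 <= B by apply: divr_ge0; [apply: mulr_ge0|apply: sqr_ge0].
have far u : eta / 2 <= `|u| -> 2 * `|M| <= B * u ^+ 2.
  move=> etau; have : (eta / 2) ^+ 2 <= u ^+ 2.
    rewrite -(real_normK (num_real u)) lerXn2r ?nnegrE //; lra.
  move=> h; rewrite /B mulrAC ler_pdivlMr ?exprn_gt0 //.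
  by have := ler_wpM2l (normr_ge0 M) h; lra.
(* [psi] is only known on [K], so the sample at [u] is the value of [psi] at
   some point of [K] whose coordinate is near [u], and 0 if there is none *)
have sample (u : R) : exists c, forall z, K z ->
    normc (c - psi z) <= e / 2 + B * (u - t z) ^+ 2.
  have KM' z : K z -> normc (psi z) <= `|M|.
    by move=> /KM h; rewrite (le_trans h) ?ler_norm.
  have [[x [Kx xu]]|nx] := pselect (exists x, K x /\ `|u - t x| < eta / 2).
    exists (psi x) => z Kz; have [zu|zu] := ltP `|u - t z| (eta / 2).
      apply: (@le_trans _ _ (e / 2)); last first.
        by rewrite lerDl mulr_ge0 ?sqr_ge0.
      apply: Kd => //; apply: le_trans (tdist x z Kx Kz) _.
      rewrite -etaE ler_pM2l ?mulr_gt0 //.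
      have := ler_distD u (t x) (t z); rewrite (distrC (t x) u); lra.
    have := normcB (psi x) (psi z); have := KM' x Kx; have := KM' z Kz.
    have := far _ zu; lra.
  exists 0 => z Kz; rewrite sub0r normc_opp.
  have zu : eta / 2 <= `|u - t z|.
    by rewrite leNgt; apply/negP => zu; apply: nx; exists z.
  have := KM' z Kz; have := far _ zu; have := normr_ge0 M; lra.
have [c cP] := choice sample.
pose n := (Num.truncn (2 * B / e)).+1.
have n0 : (0 : R) < n%:R by rewrite ltr0n.
have nB : 2 * B <= e * n%:R.
  by rewrite -ler_pdivrMl // mulrC ltW // /n truncnS_gt.
exists (fun z => bernstein (t z)%:C n (fun k => c (k%:R / n%:R))).
  exact: (@polyapprox_bernstein K (fun z => (t z)%:C)).
move=> z Kz; have tz := t01 z Kz.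
apply: le_trans (@bernstein_dist (t z) (e / 2) (B / n%:R ^+ 2) (- (n%:R * t z))
  (psi z) n _ tz _) _.
  move=> k; apply: le_trans (cP _ z Kz) _.
  rewrite lerD2l le_eqVlt; apply/orP; left; apply/eqP.
  by field; rewrite lt0r_neq0.
rewrite subrr expr0n addr0.
have -> : B / n%:R ^+ 2 * (n%:R * (t z * (1 - t z)))
  = B * (t z * (1 - t z)) / n%:R.
  by field; rewrite lt0r_neq0.
rewrite -lerBrDl ler_pdivrMr //.
have /andP[tz0 tz1] := tz.
have : t z * (1 - t z) <= 1 by nra.
have : 0 <= t z * (1 - t z) by nra.
by move=> h1 h2; have := ler_wpM2l B0 h2; lra.
Qed.
End density.

(** * The partial sums *)

Section recursion.
Variable R : realType.
Local Notation C := R[i].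

Lemma poly_lipschitz (p : {poly C}) : exists2 L : R, 0 < L &
  forall x y, normc x <= 1 -> normc y <= 1 ->
    normc (p.[x] - p.[y]) <= L * normc (x - y).
Proof.
elim/poly_ind: p => [|p c [L L0 pL]].
  by exists 1 => // x y _ _; rewrite !horner0 subrr normc0C mul1r normc_ge0.
have [M M0 pM] := poly_bounded p.
exists (L + M) => [|x y x1 y1]; first exact: addr_gt0.
rewrite !hornerE (_ : _ - _ = (p.[x] - p.[y]) * x + p.[y] * (x - y));
  last by ring.
apply: le_trans (normcD _ _) _; rewrite !normcM mulrDl; apply: lerD.
  by apply: le_trans (pL x y x1 y1); rewrite ler_piMr ?normc_ge0.
by rewrite ler_wpM2r ?normc_ge0 ?pM.
Qed.

(** The correction is [H * (phi - S)] for a cutoff polynomial [H]; on the radius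
   the corrected polynomial is nearly a convex combination of [S] and [phi]. *)
Lemma correction (S phi : {poly C}) (B s d eps : R) (z0 : C) :
  s < 1 -> 0 < d -> normc z0 = 1 -> z0 <> 1 -> 0 < eps -> 1 <= B ->
  (forall x : R, 0 <= x <= 1 -> normc S.[x%:C] <= B) -> normc phi.[1] < 1 ->
  exists2 s' : R, s' < 1 & forall r, s' < r -> r < 1 ->
  exists P : {poly C},
  [/\ forall z, normc z <= s -> normc P.[z] <= eps,
      forall v, normc v = 1 -> d <= normc (v - z0) ->
        normc ((S + P).[r%:C * v] - phi.[r%:C * v]) <= eps &
      forall x : R, 0 <= x <= 1 -> normc (S + P).[x%:C] <= B + eps].
Proof.
move=> s1 d0 z01 z0n1 eps0 B1 SB phi1.
have [M M0 DM] := poly_bounded (phi - S).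
have [L L0 phiL] := poly_lipschitz phi.
pose s2 := 1 - (1 - normc phi.[1]) / L.
have phi_s2 (x : R) : s2 <= x -> 0 <= x <= 1 -> normc phi.[x%:C] <= 1.
  move=> s2x /andP[x0 x1]; have nx : normc x%:C <= 1.
    by rewrite normc_real ger0_norm.
  have := normc_dist phi.[x%:C] phi.[1] 0; rewrite !subr0.
  have := phiL x%:C 1 nx; rewrite normc1C lexx => /(_ isT).
  have -> : x%:C - 1 = (x - 1)%:C by rewrite rmorphB rmorph1.
  rewrite normc_real ler0_norm; last by lra.
  move=> h1 h2; have : (1 - x) * L <= 1 - normc phi.[1].
    by rewrite -ler_pdivlMr //; rewrite /s2 in s2x; lra.
  lra.
pose s' := Num.max 2^-1 (Num.max s s2).
have s'1 : s' < 1.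
  rewrite !gt_max s1 /s2 ltrBlDr ltrDl divr_gt0 ?subr_gt0 // andbT; lra.
have s'2 : 0 < s' by rewrite !lt_max; apply/orP; left; lra.
exists s' => // r s'r r1.
have [H [Hs Hr Hx]] := @cutoff_polynomial R s' r d z0 (eps / M) s'2 s'r r1 d0
  z01 z0n1
  (divr_gt0 eps0 M0).
have D_le (a z : C) : normc z <= 1 -> normc a <= eps / M ->
    normc (a * (phi - S).[z]) <= eps.
  move=> z1 ae; rewrite normcM -[leRHS](divfK (lt0r_neq0 M0)).
  by rewrite ler_pM ?normc_ge0 ?DM.
have ss' : s <= s' by rewrite !le_max lexx !orbT.
exists (H * (phi - S)); split.
- move=> z zs; rewrite hornerM; apply: D_le; last by apply: Hs; lra.
  lra.
- move=> v v1 vd; have rv1 : normc (r%:C * v) <= 1.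
    by rewrite normcM normc_real v1 mulr1 ger0_norm; lra.
  have := D_le _ _ rv1 (Hr v v1 vd).
  set z := r%:C * v; rewrite !hornerE.
  by rewrite (_ : _ * _ = S.[z] + H.[z] * (phi.[z] - S.[z]) - phi.[z]) //; ring.
- move=> x x01; have /andP[x0 x1] := x01.
  have nx : normc x%:C <= 1 by rewrite normc_real ger0_norm.
  have Sx := SB x x01.
  have [xs'|xs'] := leP x s'.
    have := D_le _ _ nx (Hs x%:C _);
      rewrite normc_real ger0_norm // => /(_ xs').
    rewrite [in X in _ -> X]hornerD [in X in _ -> X]hornerM => h.
    by have := normcD S.[x%:C] (H.[x%:C] * (phi - S).[x%:C]); lra.
  have [y /andP[y0 y1] Hy] := Hx x x01.
  have phix : normc phi.[x%:C] <= 1.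
    apply: phi_s2 => //; apply: le_trans (ltW xs').
    by rewrite !le_max lexx !orbT.
  have := D_le _ _ nx Hy; rewrite !hornerE => h.
  have -> : S.[x%:C] + H.[x%:C] * (phi.[x%:C] - S.[x%:C]) =
    (1 - y)%:C * S.[x%:C] + y%:C * phi.[x%:C] +
    (H.[x%:C] - y%:C) * (phi.[x%:C] - S.[x%:C]).
    by rewrite rmorphB rmorph1; ring.
  apply: le_trans (normcD _ _) _; apply: lerD h.
  apply: le_trans (normcD _ _) _; rewrite !normcM !normc_real.
  rewrite (ger0_norm y0) ger0_norm; last by lra.
  have : y * normc phi.[x%:C] <= y * 1 by rewrite ler_wpM2l.
  have y1' : 0 <= 1 - y by lra.
  by have := ler_wpM2l y1' Sx; nra.
Qed.

Lemma radii_above (rho : radii R) (s : R) : s < 1 -> exists m, s < rho m < 1.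
Proof.
move=> s1; have /cvgrPdist_lt/(_ (1 - s)) := @radius_cvg _ rho.
rewrite subr_gt0 => /(_ s1)[m _ /(_ m (leqnn m)) h].
have /andP[r0 r1] := radius_itv rho m.
by exists m; rewrite r1 andbT; move: h; rewrite ger0_norm; lra.
Qed.

(** The tolerance at step [n]. *)
Definition dyadic (n : nat) : R := 2^-1 ^+ n.

Lemma dyadic_gt0 n : 0 < dyadic n. Proof. by rewrite exprn_gt0. Qed.

Lemma dyadicS n : dyadic n = 2 * dyadic n.+1.
Proof. by rewrite /dyadic exprS mulrA divff ?mul1r. Qed.

Lemma dyadic_le1 n : dyadic n <= 1.
Proof. by rewrite exprn_ile1 // invf_le1 // ler1n. Qed.

(** Up to [e], [S] agrees with [phi] on a circle whose radius is some [rho m] in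
   [[t, t']], outside of the gap of half-width [d] around the ray of [z0]. *)
Definition reaches (rho : radii R) (S phi : {poly C}) (z0 : C) (d t t' e : R) :=
  exists m, [/\ t <= rho m, rho m <= t' & forall v, normc v = 1 ->
    d <= normc (v - z0) ->
    normc (S.[(rho m)%:C * v] - phi.[(rho m)%:C * v]) <= e].

(** The correction of step [n] is small on the disc of radius [t n], and makes
   [S n.+1] agree with [phi n] on an arc of larger radius. On the segment from
   0 to 1 the bound grows only by the tolerance, from [2 - dyadic n] to [2 -
   dyadic n.+1]. *)
Lemma partial_sums (rho : radii R) (phi : nat -> {poly C}) (z0 : nat -> C)
    (d : nat -> R) :
  (forall n, normc (z0 n) = 1 /\ z0 n <> 1) -> (forall n, 0 < d n) ->
  (forall n, normc (phi n).[1] < 1) ->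
  exists (S : nat -> {poly C}) (t : nat -> R),
  [/\ forall n, t n < 1 /\ t n <= t n.+1,
      forall n, 1 - n.+1%:R^-1 <= t n.+1,
      forall n z, normc z <= t n
        -> normc ((S n.+1).[z] - (S n).[z]) <= dyadic n.+1,
      forall n (x : R), 0 <= x <= 1 -> normc (S n).[x%:C] <= 2 &
      forall n, reaches rho (S n.+1) (phi n) (z0 n) (d n) (t n) (t n.+1)
        (dyadic n.+1)].
Proof.
move=> z0P d0 phi1.
pose inv n (st : {poly C} * R) := st.2 < 1 /\
  forall x : R, 0 <= x <= 1 -> normc st.1.[x%:C] <= 2 - dyadic n.
pose post n (st st' : {poly C} * R) := [/\ inv n.+1 st', st.2 <= st'.2,
  1 - n.+1%:R^-1 <= st'.2,
  forall z, normc z <= st.2 -> normc (st'.1.[z] - st.1.[z]) <= dyadic n.+1 &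
  reaches rho st'.1 (phi n) (z0 n) (d n) st.2 st'.2 (dyadic n.+1)].
have stepP (nst : nat * ({poly C} * R)) : exists st', inv nst.1 nst.2 ->
    post nst.1 nst.2 st'.
  case: nst => n [S t] /=.
  have [[t1 SB]|//] := pselect (inv n (S, t)); last by exists (0, 0).
  have [z01 z0n1] := z0P n.
  have B1 : 1 <= 2 - dyadic n by have := dyadic_le1 n; lra.
  have [s' s'1 sP] := correction t1 (d0 n) z01 z0n1 (dyadic_gt0 n.+1) B1 SB
    (phi1 n).
  have [m /andP[ms' m1]] := @radii_above rho (Num.max t s') ltac:(by rewrite
    gt_max t1).
  move: ms'; rewrite gt_max => /andP[tm s'm].
  have [P [Ps Pr Px]] := sP _ s'm m1.
  pose t' := Num.max (rho m) (1 - n.+1%:R^-1).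
  have mt' : rho m <= t' by rewrite le_max lexx.
  exists (S + P, t') => _; split => /=.
  - split => /= [|x x01].
      by rewrite gt_max m1 ltrBlDr ltrDl invr_gt0 ltr0n.
    by have := Px x x01; rewrite (dyadicS n); lra.
  - by apply: le_trans mt'; exact: ltW.
  - by rewrite le_max lexx orbT.
  - by move=> z zt; rewrite hornerD addrAC subrr add0r; exact: Ps.
  - by exists m; split => //; exact: ltW.
have [next nextP] := choice stepP.
pose st := fix st n := if n is k.+1 then next (k, st k) else (0, 0) : {poly C}
  * R.
have stI n : inv n (st n).
  elim: n => [|n IHn]; last by have [] := nextP (n, st n) IHn.
  by split => //= x _; rewrite horner0 normc0C; have := dyadic_le1 0; lra.
have stP n : post n (st n) (st n.+1) by exact: (nextP (n, st n) (stI n)).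
exists (fun n => (st n).1), (fun n => (st n).2); split.
- by move=> n; have [] := stP n; have [] := stI n.
- by move=> n; have [] := stP n.
- by move=> n; have [] := stP n.
- move=> n x x01; have [_ /(_ x x01)] := stI n.
  by have := dyadic_gt0 n; lra.
- by move=> n; have [] := stP n.
Qed.

End recursion.

(** * Cauchy's estimates for polynomials *)

Section cauchy_estimates.
Variable R : realType.
Local Notation C := R[i].

Lemma normc_sum (I : Type) (r : seq I) (P : pred I) (F : I -> C) :
  normc (\sum_(i <- r | P i) F i) <= \sum_(i <- r | P i) normc (F i).
Proof.
elim/big_ind2: _ => [|x a y b xa yb|//]; first by rewrite normc0C.
by apply: le_trans (normcD _ _) _; apply: lerD.
Qed.

Lemma complex_prim_root n : (0 < n)%N -> exists w : C, n.-primitive_root w.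
Proof.
move=> n0; pose p : {poly C} := 'X^n - 1.
have [r Dp] := closed_field_poly_normal p.
rewrite (monicP _) ?monicXnsubC // scale1r in Dp.
have rn1 : all n.-unity_root r by apply/allP => z; rewrite -root_prod_XsubC -Dp.
have sz_r : (n < (size r).+1)%N.
  by rewrite -(size_prod_XsubC r id) -Dp size_XnsubC.
have [|z _ zP] := hasP (has_prim_root n0 rn1 _ sz_r); last by exists z.
by rewrite -separable_prod_XsubC -Dp separable_Xn_sub_1 // pnatr_eq0 -lt0n.
Qed.

Lemma sum_prim_root n (w : C) m : n.-primitive_root w ->
  \sum_(k < n) w ^+ (m * k) = if (n %| m)%N then n%:R else 0.
Proof.
move=> wn; under eq_bigr do rewrite exprM.
case: ifPn => [|nm].
  rewrite (prim_order_dvd wn) => /eqP ->; under eq_bigr do rewrite expr1n.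
  by rewrite sumr_const card_ord.
rewrite (prim_order_dvd wn) in nm.
apply/(mulfI (_ : w ^+ m - 1 != 0)); first by rewrite subr_eq0.
by rewrite -subrX1 mulr0 -exprM mulnC exprM (prim_expr_order wn) expr1n subrr.
Qed.

(** The scaled coefficient [q`_j * rho ^+ j] is the mean, weighted by roots of
   unity, of the values of [q] at the vertices of a regular polygon with [size
   q] vertices: a discrete form of Cauchy's formula. *)
Lemma cauchy_estimate (q : {poly C}) (rho M : R) j : 0 < rho ->
  (forall h, normc h <= rho -> normc q.[h] <= M) ->
  normc q`_j * rho ^+ j <= M.
Proof.
move=> rho0 qM; have [jn|nj] := ltnP j (size q); last first.
  rewrite nth_default // normc0C mul0r (le_trans (normc_ge0 q.[0])) //.
  by apply: qM; rewrite normc0C ltW.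
set n := size q in jn; have n0 : (0 < n)%N by exact: leq_ltn_trans jn.
have [w wn] := complex_prim_root n0.
have w1 : normc w = 1.
  by apply/eqP; rewrite -(pexpr_eq1 n0) ?normc_ge0 // -normcX prim_expr_order
    // normc1C.
pose A := \sum_(k < n) q.[rho%:C * w ^+ k] * w ^+ ((n - j) * k).
have -> : normc q`_j * rho ^+ j = normc A / n%:R.
  have -> : A = n%:R * (q`_j * rho%:C ^+ j).
    rewrite /A; under eq_bigr do rewrite horner_coef mulr_suml.
    rewrite exchange_big /= (bigD1 (Ordinal jn)) //= [X in _ + X]big1 ?addr0.
      rewrite [LHS](_ : _ = q`_j * rho%:C ^+ j * \sum_(k < n) w ^+ (n * k)).
        by rewrite sum_prim_root // dvdnn mulrC.
      rewrite mulr_sumr; apply: eq_bigr => k _.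
      have -> : (n * k = k * j + (n - j) * k)%N.
        by rewrite mulnBl (mulnC k) subnKC // leq_mul2r ltnW ?orbT.
      by rewrite exprMn -exprM exprD; ring.
    move=> i ij; rewrite (_ : \sum_(k < n) _ =
        q`_i * rho%:C ^+ i * \sum_(k < n) w ^+ ((i + (n - j)) * k)).
      rewrite sum_prim_root // ifN ?mulr0 //.
      apply: contra ij => /dvdnP[[|[|k]] ik]; have := ltn_ord i; first by lia.
        by move=> _; apply/eqP/val_inj => /=; lia.
      by lia.
    rewrite mulr_sumr; apply: eq_bigr => k _.
    by rewrite exprMn -exprM mulnDl exprD (mulnC k); ring.
  rewrite !normcM normc_nat normcX normc_real (ger0_norm (ltW rho0)).
  by rewrite mulrAC divff ?mul1r // pnatr_eq0 -lt0n.
rewrite ler_pdivrMr ?ltr0n //; apply: le_trans (normc_sum _ _ _) _.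
rewrite [leRHS](_ : _ = \sum_(k < n) M); last first.
  by rewrite sumr_const card_ord mulr_natr.
apply: ler_sum => k _; rewrite normcM !normcX w1 expr1n mulr1.
by apply: qM; rewrite normcM normcX w1 expr1n mulr1 normc_real (ger0_norm (ltW
  rho0)).
Qed.

Lemma geometric_le2 (x : R) n : 0 <= x <= 2^-1 -> \sum_(i < n) x ^+ i <= 2.
Proof.
move=> /andP[x0 x2]; have x1 : 0 < 1 - x by lra.
rewrite -(ler_pM2r x1) mulrC -opprB mulNr -subrX1 opprB.
have : 0 <= x ^+ n by exact: exprn_ge0.
lra.
Qed.

Lemma taylor_remainder (q : {poly C}) (rho M : R) (h : C) : 0 < rho ->
  (forall h, normc h <= rho -> normc q.[h] <= M) -> normc h <= rho / 2 ->
  normc (q.[h] - q.[0] - q`_1 * h) <= 2 * M / rho ^+ 2 * normc h ^+ 2.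
Proof.
move=> rho0 qM h2; have cq := cauchy_estimate _ rho0 qM.
have -> : q.[h] - q.[0] - q`_1 * h = (drop_poly 2 q).[h] * h ^+ 2.
  rewrite -{1}[q](poly_take_drop 2) horner_coef0 hornerD hornerM hornerXn.
  suff -> : (take_poly 2 q).[h] = q`_0 + q`_1 * h by ring.
  rewrite (horner_coef_wide _ (size_take_poly 2 q)).
  by rewrite !big_ord_recr big_ord0 /= !coef_take_poly /= expr0 expr1 mulr1
    add0r.
rewrite normcM normcX ler_wpM2r ?exprn_ge0 ?normc_ge0 //.
rewrite horner_coef; apply: le_trans (normc_sum _ _ _) _.
have M0 : 0 <= M.
  by apply: le_trans (normc_ge0 q.[0]) _; apply: qM; rewrite normc0C ltW.
pose x := normc h / rho.
have x2 : 0 <= x <= 2^-1.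
  by rewrite divr_ge0 ?normc_ge0 ?(ltW rho0) //= ler_pdivrMr //; lra.
apply: le_trans (_ : \sum_(i < size (drop_poly 2 q)) M / rho ^+ 2 * x ^+ i <=
  _).
  apply: ler_sum => i _; rewrite normcM normcX coef_drop_poly.
  have := cq (i + 2)%N; rewrite exprD => ci.
  rewrite /x expr_div_n.
  have -> : M / rho ^+ 2 * (normc h ^+ i / rho ^+ i) =
      M / (rho ^+ i * rho ^+ 2) * normc h ^+ i by rewrite (invfM (rho ^+ i));
        ring.
  rewrite ler_wpM2r ?exprn_ge0 ?normc_ge0 //.
  by rewrite ler_pdivlMr // mulr_gt0 ?exprn_gt0.
have MM : 0 <= M / rho ^+ 2 by rewrite divr_ge0 // exprn_ge0 // ltW.
rewrite -mulr_sumr; apply: le_trans (ler_wpM2l MM (geometric_le2 _ x2)) _.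
by rewrite le_eqVlt; apply/orP; left; apply/eqP; ring.
Qed.
End cauchy_estimates.

(** * The limit function *)

Section limit_function.
Variable R : realType.
Local Notation C := R[i].

Lemma dyadic_anti m n : (m <= n)%N -> dyadic R n <= dyadic R m.
Proof.
move=> mn; rewrite /dyadic -(subnK mn) exprD ler_piMl ?exprn_ge0 //.
exact: dyadic_le1.
Qed.

Lemma dyadic_small (e : R) n0 : 0 < e ->
  exists2 n, (n0 <= n)%N & dyadic R n <= e.
Proof.
move=> e0; have [|//|n ne] := @expr_small R 2^-1 e; first by lra.
exists (n + n0)%N; first exact: leq_addl.
by apply: le_trans ne; apply: dyadic_anti; exact: leq_addr.
Qed.

Lemma real_cauchy_limit (u : nat -> R) n0 c :
  (forall n, (n0 <= n)%N -> `|u n.+1 - u n| <= c * dyadic R n.+1) ->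
  exists l, forall n, (n0 <= n)%N -> `|u n - l| <= c * dyadic R n.
Proof.
move=> uc; have c0 : 0 <= c.
  have := le_trans (normr_ge0 _) (uc n0 (leqnn _)).
  by rewrite pmulr_lge0 // dyadic_gt0.
have lo n : (n0 <= n)%N ->
    u n - c * dyadic R n <= u n.+1 - c * dyadic R n.+1.
  by move=> /uc; rewrite ler_norml (dyadicS R n) => /andP[]; lra.
have hi n : (n0 <= n)%N ->
    u n.+1 + c * dyadic R n.+1 <= u n + c * dyadic R n.
  by move=> /uc; rewrite ler_norml (dyadicS R n) => /andP[]; lra.
have lohi m n : (n0 <= m)%N -> (n0 <= n)%N ->
    u m - c * dyadic R m <= u n + c * dyadic R n.
  move=> m0 n0'; have [k mk nk] : exists2 k, (m <= k)%N & (n <= k)%N.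
    by exists (maxn m n); rewrite ?leq_maxl ?leq_maxr.
  have lok : u m - c * dyadic R m <= u k - c * dyadic R k.
    rewrite -(subnKC mk).
    elim: (k - m)%N => [|i IHi]; first by rewrite addn0.
    by rewrite addnS (le_trans IHi) // lo // (leq_trans m0) // leq_addr.
  have hik : u k + c * dyadic R k <= u n + c * dyadic R n.
    rewrite -(subnKC nk).
    elim: (k - n)%N => [|i IHi]; first by rewrite addn0.
    by rewrite addnS (le_trans _ IHi) // hi // (leq_trans n0') // leq_addr.
  by have := mulr_ge0 c0 (ltW (dyadic_gt0 R k)); lra.
pose A := [set u m - c * dyadic R m | m in [set m | (n0 <= m)%N]].
have Aub n : (n0 <= n)%N -> ubound A (u n + c * dyadic R n).
  by move=> n0n _ [m /= m0 <-]; exact: lohi.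
have A0 : A !=set0 by exists (u n0 - c * dyadic R n0), n0 => /=.
exists (sup A) => n n0n.
have h1 : u n - c * dyadic R n <= sup A.
  by apply: ub_le_sup; [exists (u n0 + c * dyadic R n0); exact: Aub|exists n].
have h2 : sup A <= u n + c * dyadic R n by apply: ge_sup => //; exact: Aub.
by rewrite ler_norml; apply/andP; split; lra.
Qed.

Lemma complex_cauchy_limit (u : nat -> C) n0 c :
  (forall n, (n0 <= n)%N -> normc (u n.+1 - u n) <= c * dyadic R n.+1) ->
  exists l, forall n, (n0 <= n)%N -> normc (u n - l) <= 2 * c * dyadic R n.
Proof.
move=> uc.
have [n n0n|a aP] := @real_cauchy_limit (fun n => Re (u n)) n0 c.
  by apply: le_trans (uc n n0n); rewrite -raddfB Re_le_normc.
have [n n0n|b bP] := @real_cauchy_limit (fun n => Im (u n)) n0 c.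
  by apply: le_trans (uc n n0n); rewrite -raddfB Im_le_normc.
exists (a +i* b) => n n0n; apply: le_trans (normc_le_ReIm _) _.
rewrite !raddfB /=; have := aP n n0n; have := bP n n0n; lra.
Qed.

Variables (S : nat -> {poly C}) (t : nat -> R).

Lemma nondecreasing_radii : (forall n, t n <= t n.+1) ->
  forall m n, (m <= n)%N -> t m <= t n.
Proof.
move=> tS m n mn; rewrite -(subnKC mn).
by elim: (n - m)%N => [|i IHi]; rewrite ?addn0 // addnS (le_trans IHi).
Qed.

Lemma exhausting_radii : (forall n, 1 - n.+1%:R^-1 <= t n.+1) ->
  forall a : R, a < 1 -> exists n, a <= t n.
Proof.
move=> t1 a a1; pose n := Num.truncn (1 - a)^-1.
exists n.+1; apply: le_trans (t1 n); rewrite lerBrDr -lerBrDl.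
rewrite invf_ple ?posrE ?subr_gt0 ?ltr0n //.
by rewrite ltW // truncnS_gt.
Qed.

(** Around [z] the partial sums are uniformly bounded, hence so are their Taylor
   remainders of order 2; their derivatives at [z] converge by Cauchy's
   estimate. *)
Lemma limit_function : (forall n, t n < 1 /\ t n <= t n.+1) ->
  (forall n, 1 - n.+1%:R^-1 <= t n.+1) ->
  (forall n z, normc z <= t n ->
     normc ((S n.+1).[z] - (S n).[z]) <= dyadic R n.+1) ->
  exists f : C -> C,
    (forall n z, normc z <= t n -> normc ((S n).[z] - f z) <= 2 * dyadic R n) /\
    (forall z, normc z < 1 -> exists D (delta B : R),
       [/\ 0 < delta, 0 < B & forall h, normc h <= delta ->
       normc (f (z + h) - f z - D * h) <= B * normc h ^+ 2]).
Proof.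
move=> tP t1 SP.
have tmono m n : (m <= n)%N -> t m <= t n.
  by apply: nondecreasing_radii => k; have [] := tP k.
have tex := exhausting_radii t1.
have limP z : exists l, forall n, normc z <= t n ->
    normc ((S n).[z] - l) <= 2 * dyadic R n.
  have [ex|nex] := pselect (exists n, normc z <= t n); last first.
    by exists 0 => n zn; exfalso; apply: nex; exists n.
  case: (ex_minnP ex) => n0 zn0 n0min.
  have [n n0n|l lP] := @complex_cauchy_limit (fun n => (S n).[z]) n0 1.
    by rewrite mul1r; apply: SP; apply: le_trans zn0 _; exact: tmono.
  by exists l => n zn; have := lP n (n0min n zn); rewrite mulr1.
have [f fP'] := choice limP.
have fP n z : normc z <= t n -> normc ((S n).[z] - f z) <= 2 * dyadic R n
  by exact: fP'.
exists f; split => // z z1.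
pose rho := (1 - normc z) / 2; have rho0 : 0 < rho by rewrite /rho; lra.
have rho1 : rho <= 1 by rewrite /rho; have := normc_ge0 z; lra.
have [n0 zn0] : exists n, normc z + rho <= t n by apply: tex; rewrite /rho; lra.
have [M M0 SM] := poly_bounded (S n0).
have near w : normc w <= rho -> normc (w + z) <= t n0.
  by move=> wr; have := normcD w z; lra.
have nearn w n : (n0 <= n)%N -> normc w <= rho -> normc (w + z) <= t n.
  by move=> /tmono tn /near; lra.
pose q n := S n \Po ('X + z%:P).
have qE n h : (q n).[h] = (S n).[h + z] by rewrite horner_comp !hornerE.
have qM n : (n0 <= n)%N -> forall h, normc h <= rho -> normc (q n).[h] <= M + 4.
  move=> n0n h hr; rewrite qE; set w := h + z.
  have h1 := fP n w (nearn _ _ n0n hr); have h2 := fP n0 w (near _ hr).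
  have wt : normc w <= 1 by have := near _ hr; have [] := tP n0; rewrite -/w;
    lra.
  have := SM w wt; have := dyadic_le1 R n; have := dyadic_le1 R n0.
  have := normc_dist (S n).[w] (f w) 0; have := normc_dist (f w) (S n0).[w] 0.
  rewrite !subr0 (normc_distC (f w)); lra.
have [n n0n|D DP] := @complex_cauchy_limit (fun n => (q n)`_1) n0 rho^-1.
  rewrite mulrC ler_pdivlMr // -coefB -[rho]expr1.
  apply: cauchy_estimate => // h hr; rewrite hornerD hornerN !qE.
  by apply: SP; exact: nearn.
exists D, (rho / 2), (2 * (M + 4) / rho ^+ 2); split => [||h h2].
- by lra.
- by rewrite divr_gt0 ?exprn_gt0 //; lra.
have hr : normc h <= rho by lra.
apply/ler_addgt0Pr => e e0.
pose A := 4 + 2 / rho; have A0 : 0 < A.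
  by have : 0 < 2 / rho by [rewrite divr_gt0]; rewrite /A; lra.
have [n n0n ne] := dyadic_small n0 (divr_gt0 e0 A0).
have := taylor_remainder rho0 (qM n n0n) h2; rewrite !qE add0r => tay.
have n0r : normc (0 : C) <= rho by rewrite normc0C ltW.
have h1 := fP n (h + z) (nearn _ _ n0n hr).
have h3 := fP n (0 + z) (nearn _ _ n0n n0r); rewrite add0r in h3.
have h4 := DP n n0n.
have -> : f (z + h) - f z - D * h =
   ((S n).[h + z] - (S n).[z] - (q n)`_1 * h) + ((S n).[z] - f z)
   + ((q n)`_1 - D) * h - ((S n).[h + z] - f (h + z)).
  by rewrite (addrC z); ring.
apply: le_trans (normcB _ _) _; apply: le_trans (lerD (normcD _ _) (lexx _)) _.
rewrite normcM.
have h5 : normc ((q n)`_1 - D) * normc h <= 2 / rho * dyadic R n.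
  rewrite -[leRHS]mulr1 ler_pM ?normc_ge0 //; lra.
have h6 : A * dyadic R n <= e by rewrite mulrC -ler_pdivlMr.
have := normcD ((S n).[h + z] - (S n).[z] - (q n)`_1 * h) ((S n).[z] - f z).
rewrite /A in h6; lra.
Qed.
End limit_function.

(** * Countably many targets *)

Section targets.
Variable R : realType.
Local Notation C := R[i].

(** Complex numbers with rational real and imaginary parts. *)
Definition gauss_rat (ab : rat * rat) : C := ratr ab.1 +i* ratr ab.2.

Lemma gauss_rat_dense (c : C) (e : R) : 0 < e ->
  exists ab, normc (gauss_rat ab - c) <= e.
Proof.
move=> e0; have rat_near (x : R) : exists a : rat, `|ratr a - x| <= e / 2.
  have [|a] := @rat_in_itvoo R (x - e / 2) (x + e / 2); first by lra.
  rewrite in_itv /= => /andP[a1 a2]; exists a.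
  by rewrite ler_norml; apply/andP; split; lra.
have [a aP] := rat_near (Re c); have [b bP] := rat_near (Im c).
exists (a, b); apply: le_trans (normc_le_ReIm _) _; rewrite !raddfB /=; lra.
Qed.

(** Polynomials with such coefficients, lowest degree first. *)
Definition rat_poly (s : seq (rat * rat)) : {poly C} := Poly (map gauss_rat s).

Lemma rat_poly_dense (p : {poly C}) (e : R) : 0 < e ->
  exists s, forall z, normc z <= 1 -> normc ((rat_poly s).[z] - p.[z]) <= e.
Proof.
elim/poly_ind: p e => [|p c IHp] e e0.
  by exists [::] => z _; rewrite horner0 subrr normc0C ltW.
have e2 : 0 < e / 2 by lra.
have [s sP] := IHp _ e2; have [ab abP] := gauss_rat_dense c e2.
exists (ab :: s) => z z1; rewrite /rat_poly /= cons_poly_def !hornerE.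
rewrite -/(rat_poly s) (_ : _ - _ = ((rat_poly s).[z] - p.[z]) * z
  + (gauss_rat ab - c)); last by ring.
apply: le_trans (normcD _ _) _; rewrite normcM.
have := sP z z1; have := ler_piMr (normc_ge0 ((rat_poly s).[z] - p.[z])) z1.
lra.
Qed.

(** Composed with the 2-adic valuation, the enumeration of [T] takes each of its
   values infinitely often. *)
Lemma repeated_enumeration (T : countType) (x : T) N :
  exists2 n, (N <= n)%N & unpickle (logn 2 n) = Some x.
Proof.
exists (2 ^ pickle x * (N.*2).+1)%N.
  have : (0 < 2 ^ pickle x)%N by rewrite expn_gt0.
  by nia.
rewrite lognM ?expn_gt0 // pfactorK // logn_coprime ?addn0 ?pickleK //.
by rewrite coprime2n /= odd_double.
Qed.

(** [(s, q, j)] asks for the approximation of [rat_poly s] outside of the gap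
   of half-width [j.+1%:R^-1] around [cayley (ratr q)]. *)
Definition target := (seq (rat * rat) * rat * nat)%type.

(** The theorem without topologies: [f] is complex differentiable in the disc,
   bounded on the radius, and its dilates approximate uniformly, on every set
   [K] that contains 1 and leaves a gap around some [cayley (ratr q)], the
   uniformly continuous functions with modulus less than 1 at 1. *)
Lemma universal_core (rho : radii R) : exists f : C -> C,
  [/\ forall z, normc z < 1 -> exists D (delta B : R),
       [/\ 0 < delta, 0 < B & forall h, normc h <= delta ->
       normc (f (z + h) - f z - D * h) <= B * normc h ^+ 2],
      forall x : R, 0 <= x < 1 -> normc (f x%:C) <= 4 &
      forall (K : set C) (q : rat) (d M : R) (psi : C -> C), 0 < d ->
        (forall v, K v -> normc v = 1 /\ d <= normc (v - cayley (ratr q))) ->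
        (forall v, K v -> normc (psi v) <= M) -> unif_cont_on K psi ->
        K 1 -> normc (psi 1) < 1 ->
        forall e : R, 0 < e -> exists m, forall v, K v ->
          normc (f ((rho m)%:C * v) - psi v) <= e].
Proof.
pose tgt n : target := odflt ([::], 0, 0%N) (unpickle (logn 2 n)).
(* targets that are too large at 1 are replaced by 0 *)
pose phi n : {poly C} :=
  if normc (rat_poly (tgt n).1.1).[1] < 1 then rat_poly (tgt n).1.1 else 0.
pose z0 n : C := cayley (ratr (tgt n).1.2).
pose d n : R := (tgt n).2.+1%:R^-1.
have z0P n : normc (z0 n) = 1 /\ z0 n <> 1.
  by split; [exact: normc_cayley|exact: cayley_neq1].
have d0 n : 0 < d n by rewrite invr_gt0 ltr0n.
have phi1 n : normc (phi n).[1] < 1.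
  by rewrite /phi; case: ifP => // _; rewrite horner0 normc0C ltr01.
have [S [t [tP t1 SP S2 Sreach]]] := partial_sums rho z0P d0 phi1.
have tmono := nondecreasing_radii (fun n => (tP n).2).
have tex := exhausting_radii t1.
have [f [fS fD]] := limit_function tP t1 SP.
exists f; split => // [x /andP[x0 x1]|K q r M psi r0 KP psiM psiuc K1 psi1 e
  e0].
  have [n xn] := tex x x1; have nx : normc x%:C <= t n
    by rewrite normc_real ger0_norm.
  have := fS n _ nx; have := S2 n x; rewrite x0 ltW // => /(_ isT).
  have := normc_dist (f x%:C) (S n).[x%:C] 0; have := dyadic_le1 R n.
  rewrite !subr0 (normc_distC (f _)); lra.
pose e1 := Num.min (e / 8) ((1 - normc (psi 1)) / 4).
have e10 : 0 < e1 by rewrite lt_min; apply/andP; split; lra.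
have e1e : e1 <= e / 8 by rewrite ge_min lexx.
have e1p : e1 <= (1 - normc (psi 1)) / 4 by rewrite ge_min lexx orbT.
have [p pP] := polyapprox_arc (normc_cayley (ratr q)) r0 KP psiM psiuc e10.
have [s sP] := rat_poly_dense p e10.
have K1le v : K v -> normc v <= 1 by move=> /KP[->].
have sK v : K v -> normc ((rat_poly s).[v] - psi v) <= 2 * e1.
  move=> Kv; have := sP v (K1le v Kv); have := pP v Kv.
  have := normc_dist (rat_poly s).[v] p.[v] (psi v); lra.
have s1 : normc (rat_poly s).[1] < 1.
  have := sK 1 K1; have := normc_dist (rat_poly s).[1] (psi 1) 0.
  rewrite !subr0; lra.
have [L L0 sL] := poly_lipschitz (rat_poly s).
pose j := Num.truncn r^-1.
have jr : j.+1%:R^-1 <= r.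
  by rewrite invf_ple ?posrE ?ltr0n // ltW // truncnS_gt.
have [N1 _ N1e] : exists2 n, (0 <= n)%N & dyadic R n <= e / 12.
  by apply: dyadic_small; lra.
have [N2 N2e] : exists n, 1 - e / (4 * L) <= t n.
  by apply: tex; rewrite ltrBlDr ltrDl divr_gt0 // mulr_gt0.
have [n nN nE] := @repeated_enumeration target (s, q, j) (maxn N1 N2).
have N1n : (N1 <= n)%N by exact: leq_trans (leq_maxl _ _) nN.
have N2n : (N2 <= n)%N by exact: leq_trans (leq_maxr _ _) nN.
have [m [tm mt mP]] := Sreach n.
move: mP; rewrite /phi /z0 /d /tgt nE /= s1 => mP.
exists m => v Kv; have [v1 vr] := KP v Kv.
have /andP[rm0 rm1] := radius_itv rho m.
have nv : normc ((rho m)%:C * v) = rho m.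
  by rewrite normcM normc_real v1 mulr1 ger0_norm.
have h1 := mP v v1 (le_trans jr vr).
have h2 : normc ((S n.+1).[(rho m)%:C * v] - f ((rho m)%:C * v)) <= 2 * dyadic
  R n.+1.
  by apply: fS; rewrite nv.
have h3 : normc ((rat_poly s).[(rho m)%:C * v] - (rat_poly s).[v]) <= e / 4.
  apply: le_trans (sL _ _ _ _) _; [by rewrite nv ltW|exact: K1le|].
  rewrite -{2}[v]mul1r -mulrBl normcM v1 mulr1 -(rmorph1 (real_complex R))
    -rmorphB.
  rewrite normc_real ler0_norm; last by lra.
  have -> : e / 4 = L * (e / (4 * L)) by field; rewrite lt0r_neq0.
  by rewrite ler_pM2l //; have := tmono _ _ N2n; lra.
have h4 := sK v Kv.
have h5 : dyadic R n.+1 <= e / 12.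
  by apply: le_trans N1e; apply: dyadic_anti; exact: leqW.
have := normc_dist (f ((rho m)%:C * v)) (S n.+1).[(rho m)%:C * v] (psi v).
have := normc_dist (S n.+1).[(rho m)%:C * v] (rat_poly s).[(rho m)%:C * v] (psi
  v).
have := normc_dist (rat_poly s).[(rho m)%:C * v] (rat_poly s).[v] (psi v).
rewrite (normc_distC (f _) (S _).[_]); lra.
Qed.
End targets.

(** * Topology of the complex line and of function spaces *)

Section topology.
Variable R : realType.
Local Notation C := (R[i]^o).

Lemma gt0_complexP (e : R[i]) : 0 < e -> exists2 a : R, 0 < a & e = a%:C.
Proof.
move=> e0; have er := RRe_real (gtr0_real e0).
by exists (Re e) => //; rewrite -ltcR er.
Qed.

Lemma ball_normc (x y : C) (a : R) : ball x a%:C y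
  = (normc (x - y : R[i]) < a) :> Prop.
Proof. by rewrite -ball_normE /ball_ /= [`|_|]normrE ltcR. Qed.

Lemma nbhs_normcP (x : C) (A : set C) : nbhs x A <->
  exists2 a : R, 0 < a & forall y, normc (x - y : R[i]) < a -> A y.
Proof.
split=> [/nbhs_ballP[e /= /gt0_complexP[a a0 ->] xA]|[a a0 xA]].
  by exists a => // y xy; apply: xA; rewrite ball_normc.
apply/nbhs_ballP; exists a%:C; first by rewrite /= ltcR.
by move=> y; rewrite ball_normc; exact: xA.
Qed.

Lemma derivable_normc (f : C -> C) (z D : R[i]) (delta B : R) :
  0 < delta -> 0 < B ->
  (forall h : R[i], normc h <= delta ->
     normc (f (z + h) - f z - D * h : R[i]) <= B * normc h ^+ 2) ->
  derivable f z 1.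
Proof.
move=> delta0 B0 fD; apply/cvg_ex; exists D => A /nbhs_normcP[a a0 DA].
have : exists2 b : R, 0 < b & b <= delta /\ B * b <= a.
  exists (Num.min delta (a / B)); first by rewrite lt_min delta0 divr_gt0.
  split; first by rewrite ge_min lexx.
  by rewrite mulrC -ler_pdivlMr // ge_min lexx orbT.
move=> [b b0 [bd Bb]].
apply/nbhs_normcP; exists b => // h hb h0; apply: DA.
have hb' : normc (h : R[i]) < b by rewrite -normc_opp -sub0r.
have h00 : (h : R[i]) != 0 by [].
have n0 : 0 < normc (h : R[i]) by rewrite normc_gt0.
have quotE (u v w : R[i]) : u != 0 -> v - u^-1 * w = - ((w - v * u) / u).
  by move=> u0; field.
have := fD h (le_trans (ltW hb') bd) => hD.
have -> : D - h^-1 *: (f (h *: 1 + z) - f z) =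
   - ((f (z + h) - f z - D * h) / h) :> R[i].
  have -> : h *: 1 + z = z + h by rewrite [h *: 1](mulr1 (h : R[i])) addrC.
  by apply: quotE.
rewrite normc_opp normcM normcV ltr_pdivrMr //.
apply: le_lt_trans hD _; rewrite expr2 mulrA ltr_pM2r //.
by apply: lt_le_trans Bb; rewrite ltr_pM2l.
Qed.

(** Extension by 0 of a function defined on [K]. *)
Definition zero_ext (K : set C) (g : set_type K -> C) (z : C) : C :=
  if pselect (K z) is left Kz then g (exist _ z (mem_set Kz)) else 0.

Lemma zero_extE (K : set C) (g : set_type K -> C) (w : set_type K) :
  zero_ext g (\val w) = g w.
Proof.
rewrite /zero_ext; case: pselect => [Kw|nKw]; last first.
  by case: nKw; exact: set_mem (valP w).
by congr g; exact: val_inj.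
Qed.

Lemma continuous_set_type_normc (K : set C) (g : set_type K -> C) :
  continuous g -> forall (w : set_type K) (e : R), 0 < e ->
  exists2 delta : R, 0 < delta & forall w' : set_type K,
    normc (\val w - \val w' : R[i]) < delta -> normc (g w - g w' : R[i]) < e.
Proof.
move=> gc w e e0.
have : nbhs w (g @^-1` [set y | normc (g w - y : R[i]) < e]).
  by apply: gc; apply/nbhs_normcP; exists e.
rewrite nbhsE => -[B [[A oA AB] Bw] Bg].
have : nbhs (\val w : C) A by apply: open_nbhs_nbhs; split => //;
  rewrite -AB in Bw.
move=> /nbhs_normcP[delta delta0 dA]; exists delta => // w' /dA Aw'.
by apply: Bg; rewrite -AB.
Qed.

(** Heine's theorem. *)
Lemma compact_unif_cont (K : set C) (g : set_type K -> C) :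
  compact K -> continuous g -> unif_cont_on K (zero_ext g).
Proof.
move=> Kc gc e e0; have e2 : 0 < e / 2 by lra.
pose P (delta : R) (x : C) := K x -> forall y, K y
  -> normc (x - y : R[i]) <= delta ->
  normc (zero_ext g x - zero_ext g y : R[i]) <= e.
have /compact_near_coveringP/(_ _ (0 : R)^'+ P) := Kc.
move=> /(_ _)[x Kx|delta0 /= d00 dP].
  have [delta delta0 dg] :=
    continuous_set_type_normc gc (exist _ x (mem_set Kx)) e2.
  have near_x y : K y -> normc (x - y : R[i]) < delta ->
      normc (zero_ext g x - zero_ext g y : R[i]) < e / 2.
    move=> Ky xy.
    have := dg (exist _ y (mem_set Ky)) xy.
    by rewrite -(zero_extE g (exist _ x _)) -(zero_extE g (exist _ y _)).
  exists ([set y : C | normc (x - y : R[i]) < delta / 2], [set d : R | d <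
    delta / 2]).
    split => /=; first by apply/nbhs_normcP; exists (delta / 2) => //; lra.
    by apply: nbhs_right_lt; lra.
  move=> [x' d] [/= xx' dd] Kx' y Ky x'y.
  have h1 : normc (x - x' : R[i]) < delta by lra.
  have h2 : normc (x - y : R[i]) < delta
    by have := normc_dist (x : R[i]) x' y; lra.
  have := near_x _ Kx' h1; have := near_x _ Ky h2.
  have := normc_dist (zero_ext g x' : R[i]) (zero_ext g x) (zero_ext g y).
  rewrite (normc_distC (zero_ext g x') (zero_ext g x)); lra.
exists (delta0 / 2); first lra.
move=> x y Kx Ky xy; apply: (dP (delta0 / 2)) => //=; last by lra.
by rewrite sub0r normrN ger0_norm; lra.
Qed.

(** The points [cayley (ratr q)] are dense in the circle, so one of them lies
   in the complement of [K]. *)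
Lemma compact_gap (K : set C) : compact K -> K `<=` unit_circle R ->
  K <> unit_circle R -> exists (q : rat) (d : R), 0 < d /\
  forall v : R[i], K v -> normc v = 1 /\ d <= normc (v - cayley (ratr q)).
Proof.
move=> Kc KT nKT.
have K1 (v : R[i]) : K v -> normc v = 1.
  by move=> /KT; rewrite /unit_circle /= [`|_|]normrE => -[].
have [z0 z01 nKz0] : exists2 z0 : R[i], normc z0 = 1 & ~ K z0.
  apply: contrapT => h; apply: nKT; apply/seteqP; split => // z.
  rewrite /unit_circle /= [`|_|]normrE => -[z1].
  by apply: contrapT => nKz; apply: h; exists z.
have Kcl : closed K by apply: compact_closed => //; exact: norm_hausdorff.
have /nbhs_normcP[a a0 aK] : nbhs (z0 : C) (~` K).
  by apply: open_nbhs_nbhs; split => //; exact: closed_openC.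
have [s sz0] : exists s, normc (z0 - cayley s) < a / 2.
  have [z0E|/eqP z0n1] := eqVneq z0 1; last first.
    have [s ->] := cayley_onto z01 z0n1; exists s.
    by rewrite subrr normc0C; lra.
  exists (8 / a); have s0 : 0 < 8 / a by rewrite divr_gt0.
  rewrite z0E cayleyE opprD addrA subrr sub0r normc_opp !normcM normc_i mulr1.
  rewrite normc_nat.
  rewrite normcV ltr_pdivrMr ?normc_gt0 ?subi_neq0 //.
  have := Re_le_normc ((8 / a)%:C - 'i); rewrite /= subr0 gtr0_norm // => h.
  have a2 : 0 < a / 2 by lra.
  have := ler_wpM2l (ltW a2) h.
  have -> : a / 2 * (8 / a) = 4 by field; rewrite lt0r_neq0.
  lra.
have [|q] := @rat_in_itvoo R s (s + a / 8); first by lra.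
rewrite in_itv /= => /andP[q1 q2]; exists q, (a / 4); split; first by lra.
move=> v Kv; split; first exact: K1.
have va : a <= normc (z0 - v).
  by rewrite leNgt; apply/negP => /aK.
have := cayley_lipschitz s (ratr q); rewrite ler0_norm; last by lra.
have := normc_dist z0 (cayley s) v;
  have := normc_dist (cayley s) (cayley (ratr q)) v.
rewrite (normc_distC v); lra.
Qed.

(** A point [p] off [K] is isolated in the union, so the value there is free. *)
Lemma unif_cont_onU1 (K : set C) (p : C) (psi : C -> C) : closed K ->
  unif_cont_on K psi -> unif_cont_on (K `|` [set p]) psi.
Proof.
move=> Kcl Kpsi e e0; have [delta delta0 dP] := Kpsi e e0.
have [Kp|nKp] := pselect (K p).
  by exists delta => // x y [Kx|->] [Ky|->]; apply: dP.
have /nbhs_normcP[a a0 aK] : nbhs p (~` K).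
  by apply: open_nbhs_nbhs; split => //; exact: closed_openC.
have far x : K x -> a <= normc (p - x : R[i]).
  by move=> Kx; rewrite leNgt; apply/negP => /aK.
exists (Num.min delta (a / 2)) => [|x y].
  by rewrite lt_min delta0; lra.
rewrite le_min => Kx Ky /andP[xyd xya]; case: Kx Ky xyd xya => [Kx|->] [Ky|->].
- by move=> xyd _; apply: dP.
- by move=> _; rewrite normc_distC => h; have := far _ Kx; lra.
- by move=> _ h; have := far _ Ky; lra.
- by move=> _ _; rewrite subrr normc0C ltW.
Qed.

(** Neighbourhoods in [contC K] are those of uniform convergence. *)
Lemma nbhs_contC (K : set C) (g : contC K) (B : set (contC K)) :
  nbhs g B <-> exists2 a : R, 0 < a &
    forall h : contC K, (forall w, normc (g w - h w : R[i]) < a) -> B h.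
Proof.
split.
  rewrite nbhsE => -[_ [[A oA <-] Ag] AB].
  have An : @nbhs _ (arrow_uniform_type (set_type K) C) g A.
    exact: (open_nbhs_nbhs (conj oA Ag)).
  have [e /= /gt0_complexP[a a0 ->] aA] := (nbhs_ballP _ _).1 An.
  exists a => // h gh; apply/AB/aA => w; rewrite ball_normc; exact: gh.
move=> [a a0 aB].
have gb : @nbhs _ (arrow_uniform_type (set_type K) C) g
    (@ball _ (arrow_uniform_type (set_type K) C) g a%:C).
  by apply: nbhsx_ballx; rewrite ltcR.
pose W : set (arrow_uniform_type (set_type K) C) :=
  interior (@ball _ (arrow_uniform_type (set_type K) C) g a%:C).
have oW : open W by exact: open_interior.
rewrite nbhsE; exists [set h : contC K | W h].
  by split; [exists W|exact: gb].
move=> h /interior_subset gh; apply: aB => w; have := gh w;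
  by rewrite ball_normc.
Qed.

End topology.

Theorem proposition5p8 (R : realType) (rho : radii R) :
  exists f : holo_disc R,
    (forall rho' : radii R, ~ universal_for rho' (set1_unit_circle R) f) /\
    (forall (K : set R[i]^o) (KT : K `<=` unit_circle R),
       compact K -> K <> unit_circle R ->
       somewhere_dense (radial_orbit rho KT f)).
Proof.
have [f [fD f4 fU]] := universal_core rho.
have fH : holomorphic_on (unit_disc R) (f : R[i]^o -> R[i]^o).
  move=> z; rewrite /unit_disc /= [`|_|]normrE ltcR => /fD[D [delta [B [d0 B0
    DP]]]].
  exact: derivable_normc d0 B0 DP.
exists (HoloDisc fH); split => [rho' dense_f|K KT Kc nK].
  (* no [f r] is near 10, since [f] is at most 4 on the radius *)
  pose c : contC [set (1 : R[i]^o)] :=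
    mkcts (@cst_continuous (set_type [set (1 : R[i]^o)]) R[i]^o (10%:C)).
  pose O := [set h : contC [set (1 : R[i]^o)] | forall w, normc (10%:C - h w :
    R[i]) < 1].
  have : interior O !=set0.
    by exists c; apply/nbhs_contC; exists 1.
  move=> /dense_f/(_ (@open_interior _ _))[k [/interior_subset Oh [n _ hE]]].
  pose w : set_type [set (1 : R[i]^o)] := exist _ 1 (mem_set erefl).
  have kw : k w = f (rho' n)%:C.
    by rewrite -hE; congr f; exact: (mulr1 ((rho' n)%:C : R[i])).
  have := Oh w; rewrite kw.
  move=> h; have := f4 _ (radius_itv rho' n).
  have := normc_dist 10%:C (f (rho' n)%:C) 0;
    rewrite !subr0 normc_real ger0_norm //.
  lra.
have Kcl : closed K by apply: compact_closed => //; exact: norm_hausdorff.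
have [q [d [d0 Kq]]] := compact_gap Kc KT nK.
(* the open unit ball of [contC K] lies in the closure of the orbit *)
pose c : contC K := mkcts (@cst_continuous (set_type K) R[i]^o 0).
exists c.
apply/nbhs_contC; exists 1 => // g; rewrite /= => g1 B /nbhs_contC[a a0 aB].
have {}g1 w : normc (g w : R[i]) < 1.
  by have := g1 w; rewrite /= sub0r normc_opp.
pose psi := zero_ext g.
have psi1 v : normc (psi v : R[i]) < 1.
  rewrite /psi /zero_ext; case: pselect => [Kv|_]; first exact: g1.
  by rewrite normc0C ltr01.
pose d' := Num.min d (normc (1 - cayley (ratr q) : R[i])).
have d'0 : 0 < d'.
  rewrite lt_min d0 normc_gt0 subr_eq0 eq_sym; apply/eqP; exact: cayley_neq1.
have a2 : 0 < a / 2 by lra.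
(* the point 1 is added to [K], as the target must be controlled there *)
have K'q (v : R[i]) : (K `|` [set 1]) v ->
    normc v = 1 /\ d' <= normc (v - cayley (ratr q)).
  case=> [/Kq[v1 vd]|->]; rewrite ge_min; last by rewrite lexx orbT normc1C.
  by rewrite vd.
have psiuc : unif_cont_on (K `|` [set 1]) psi.
  by apply: unif_cont_onU1 => //; apply: compact_unif_cont => //;
    exact: cts_fun.
have [m mP] := fU (K `|` [set 1]) q d' 1 psi d'0
  K'q (fun v _ => ltW (psi1 v)) psiuc (or_intror erefl) (psi1 1) _ a2.
exists (radial_op rho KT m (HoloDisc fH)); split; first by exists m.
apply: aB => w; have Kw : K (\val w) by exact: set_mem (valP w).
have := mP _ (or_introl Kw); rewrite /psi zero_extE normc_distC => h.
by apply: le_lt_trans h _; lra.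
Qed.
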